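(* Consider the differentially private distributed projected gradient descent algorithm described in the context. Its expected suboptimality after $K$ iterations is bounded as $$\mathbb{E}\left[U\left(\sum_{i=1}^n\hat r_i^{(K+1)}\right)-U^*\right]\le\mathcal{O}\left(\eta\sqrt{n}\,\rho\left(\frac{G}{\sqrt K}+\frac{\sqrt2\,TK^{3/2}L\Delta}{2\epsilon}\right)\right),$$ where $U^*$ is the optimal value of the problem of minimizing $U(\sum_{i=1}^n r_i)$ subject to $r_i\in\mathcal{C}_i$, $i\in[n]$, and $$\rho=\max\left\{\sqrt{\textstyle\sum_{i=1}^n\|r_i\|^2}\colon r_i\in\mathcal{C}_i,\ i\in[n]\right\},\qquad G=\max\left\{\left\|\nabla U\left(\textstyle\sum_{i=1}^n r_i\right)\right\|\colon r_i\in\mathcal{C}_i,\ i\in[n]\right\}.$$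
   Context: $\|\cdot\|$ is the $\ell_2$-norm, $[n]=\{1,\dots,n\}$, and for a nonempty convex set $\mathcal{C}\subset\mathbb{R}^T$, $\Pi_{\mathcal{C}}(x)$ is the $\ell_2$-projection of $x$ onto $\mathcal{C}$, i.e. the minimizer of $\|\hat x-x\|^2$ over $\hat x\in\mathcal{C}$. $\mathcal{O}(\cdot)$ is big-O notation. Problem: minimize $U(\sum_{i=1}^n r_i)$ over $r_1,\dots,r_n\in\mathbb{R}^T$ subject to $r_i\in\mathcal{C}_i$, $i\in[n]$. Here $U\colon\mathbb{R}^T\to\mathbb{R}$ is convex and differentiable with $\|\nabla U(x)-\nabla U(y)\|\le L\|x-y\|$ for all $x,y$ (for some $L>0$), and each $\mathcal{C}_i\subset\mathbb{R}^T$ is convex. The sets belong to a parameterized family, $\mathcal{C}_i=\mathcal{C}(\beta_i)$ with $\beta_i\in\mathbb{R}^s$; given a metric $\rho_0$ on $\mathbb{R}^s$, set $\rho_{\mathcal{C}}(\mathcal{C}(\beta),\mathcal{C}(\beta')):=\rho_0(\beta,\beta')$. For a given constant $\delta\mathcal{C}\ge0$, $$\Delta:=\max_{i\in[n]}\max\{\|\Pi_{\mathcal{C}_i}(r)-\Pi_{\mathcal{C}_i'}(r)\|\colon r\in\mathbb{R}^T,\ \mathcal{C}_i \text{ and } \mathcal{C}_i' \text{ satisfy } \rho_{\mathcal{C}}(\mathcal{C}_i,\mathcal{C}_i')\le\delta\mathcal{C}\}.$$ The privacy level is $\epsilon>0$. Algorithm (inputs $U$, $L$, $\{\mathcal{C}_i\}_{i=1}^n$,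 number of iterations $K$, step sizes $\{\alpha_k\}_{k=1}^K$, $\eta\ge1$, $\Delta$, $\epsilon$): initialize $\{r_i^{(1)}\}_{i=1}^n$ arbitrarily, let $\hat r_i^{(1)}=r_i^{(1)}$ for $i\in[n]$ and $\theta_k=(\eta+1)/(\eta+k)$ for $k\in[K]$. For $k=1,\dots,K$: (1) if $k=1$ set $w_1=0$; otherwise draw a random vector $w_k\in\mathbb{R}^T$ from the distribution with density proportional to $\exp\left(-\frac{2\epsilon\|w_k\|}{K(K-1)L\Delta}\right)$; (2) compute $\hat p^{(k)}:=\nabla U(\sum_{i=1}^n r_i^{(k)})+w_k$; (3) for $i\in[n]$ compute $r_i^{(k+1)}:=\Pi_{\mathcal{C}_i}(r_i^{(k)}-\alpha_k\hat p^{(k)})$ and $\hat r_i^{(k+1)}:=(1-\theta_k)\hat r_i^{(k)}+\theta_k r_i^{(k+1)}$. The output is $\{\hat r_i^{(K+1)}\}_{i=1}^n$. Step sizes: $\alpha_k=c/\sqrt k$ for some $c>0$. *)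

(* Defs.v *)
(* Vectors of R^T are row vectors 'rV[R]_T; random vectors
   take their values in T.-tuple R, whose sigma-algebra the library provides. *)
From HB Require Import structures.
From mathcomp Require Import all_boot all_order all_algebra finmap.
From mathcomp Require Import all_classical all_reals all_analysis.
Set Implicit Arguments.
Unset Strict Implicit.
Unset Printing Implicit Defensive.
Import Order.TTheory GRing.Theory Num.Theory.
Import numFieldNormedType.Exports.
Local Open Scope classical_set_scope.
Local Open Scope ring_scope.

Section lebesgue_tuple.
Variable R : realType.
Local Notation tup n := (n.-tuple (measurableTypeR R)).

Definition tcons n (p : measurableTypeR R * tup n) : tup n.+1 :=
  [the _.-tuple _ of p.1 :: p.2].

Lemma measurable_tcons n : measurable_fun setT (@tcons n).
Proof. exact: measurable_cons. Qed.

HB.instance Definition _ n := isMeasurableFun.Build _ _ _ _ (@tcons n)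
  (@measurable_tcons n).

Section step.
Variables (n : nat) (mu : {sigma_finite_measure set (tup n) -> \bar R}).

Definition lebesgue_step : set (tup n.+1) -> \bar R :=
  pushforward (@lebesgue_measure R \x mu)%E (@tcons n).

Let lebesgue_step0 : lebesgue_step set0 = 0%E.
Proof. by rewrite /lebesgue_step /pushforward preimage_set0 measure0. Qed.

Let lebesgue_step_ge0 A : (0 <= lebesgue_step A)%E.
Proof. exact: measure_ge0. Qed.

Let lebesgue_step_sigma_additive : semi_sigma_additive lebesgue_step.
Proof.
move=> F mF tF mUF; rewrite /lebesgue_step.
exact: (measure_semi_sigma_additive
  (s := measure_function_pushforward__canonical__measure_function_Measure _ (@measurable_tcons n))).
Qed.

HB.instance Definition _ := isMeasure.Build _ _ _ lebesgue_step
  lebesgue_step0 lebesgue_step_ge0 lebesgue_step_sigma_additive.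

Let lebesgue_step_sigma_finite : sigma_finite setT lebesgue_step.
Proof.
have [F TF Ffin] : sigma_finite setT (@lebesgue_measure R \x mu)%E.
  have /sigma_finiteP[F [TF ndF Foo]] := sigma_finiteT (@lebesgue_measure R).
  have /sigma_finiteP[G [TG ndG Goo]] := sigma_finiteT mu.
  exists (fun k => F k `*` G k).
    rewrite -setXTT TF TG predeqE => -[x y]; split.
      move=> [/= [i _ Fix] [j _ Gjy]]; exists (maxn i j) => //; split.
      - by move: x Fix; exact/subsetPset/ndF/leq_maxl.
      - by move: y Gjy; exact/subsetPset/ndG/leq_maxr.
    by move=> [k _ []/= ? ?]; split; exists k.
  move=> k; have [? ?] := Foo k; have [? ?] := Goo k.
  split; first exact: measurableX.
  by rewrite product_measure1E// lte_mul_pinfty// ge0_fin_numE.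
have tconsK : cancel (@tcons n) (fun t => (thead t, [tuple of behead t])).
  by case=> x t /=; rewrite /tcons theadE; congr pair; exact/val_inj.
have preimK k : @tcons n @^-1` ((fun t => (thead t, [tuple of behead t]))
    @^-1` F k) = F k.
  by apply/seteqP; split=> p /=; rewrite tconsK.
exists (fun k => (fun t => (thead t, [tuple of behead t])) @^-1` F k).
  by rewrite -preimage_bigcup -TF.
move=> k; have [mFk Fkoo] := Ffin k; split; last first.
  by rewrite /lebesgue_step /pushforward preimK.
have mf : measurable_fun [set: tup n.+1]
    (fun t => (thead t, [tuple of behead t]) : measurableTypeR R * tup n).
  apply/measurable_fun_pair; first exact: measurable_tnth.
  exact: measurable_behead.
by rewrite -[X in measurable X]setTI; exact: mf.
Qed.

HB.instance Definition _ := Measure_isSigmaFinite.Build _ _ _ lebesgue_step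
  lebesgue_step_sigma_finite.
End step.

(* Lebesgue measure on R^n: the n-fold product of the Lebesgue measure on R,
   carried by n.-tuple R with its product (= Borel) sigma-algebra. *)
Fixpoint lebesgue_tuple n : {sigma_finite_measure set (tup n) -> \bar R} :=
  match n with
  | 0 => \d_ ([tuple] : tup 0)
  | m.+1 => lebesgue_step (lebesgue_tuple m)
  end.
End lebesgue_tuple.

Section euclidean.
Variable R : realType.

(* The library norm `|x| on row vectors is the sup norm. *)
Definition l2norm T (x : 'rV[R]_T) : R := Num.sqrt (\sum_(j < T) x 0 j ^+ 2).

Definition gradient T (U : 'rV[R]_T -> R) (x : 'rV[R]_T) : 'rV[R]_T :=
  \row_(j < T) 'D_(delta_mx 0 j) U x.

Definition lipschitz_gradient T (U : 'rV[R]_T -> R) (L : R) : Prop :=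
  forall x y, l2norm (gradient U x - gradient U y) <= L * l2norm (x - y).

(* p is the l2-projection of x onto C. For convex C it is unique; for closed
   nonempty C it exists. *)
Definition is_proj T (C : set 'rV[R]_T) (x p : 'rV[R]_T) : Prop :=
  C p /\ forall y, C y -> l2norm (p - x) ^+ 2 <= l2norm (y - x) ^+ 2.

Definition is_metric (X : Type) (rho : X -> X -> R) : Prop :=
  [/\ forall x y, 0 <= rho x y,
      forall x y, rho x y = 0 <-> x = y,
      forall x y, rho x y = rho y x &
      forall x y z, rho x z <= rho x y + rho y z].

End euclidean.

Section problem.
Variables (R : realType) (n T s : nat).
Implicit Types (U : 'rV[R]_T -> R) (C : 'I_n -> set 'rV[R]_T).

Definition feasible C : set ('I_n -> 'rV[R]_T) :=
  [set r | forall i, C i (r i)].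

Definition optimal_value U C : R :=
  inf [set U (\sum_(i < n) r i) | r in feasible C].

Definition norms C : set R :=
  [set Num.sqrt (\sum_(i < n) l2norm (r i) ^+ 2) | r in feasible C].

Definition gradient_norms U C : set R :=
  [set l2norm (gradient U (\sum_(i < n) r i)) | r in feasible C].

(* C b is the member of the family with parameter b; agent i uses C (beta i).
   The distance between C b and C b' is rho0 b b'. *)
Definition proj_gaps (C : 'rV[R]_s -> set 'rV[R]_T)
    (rho0 : 'rV[R]_s -> 'rV[R]_s -> R) (beta : 'I_n -> 'rV[R]_s) (dC : R) :
    set R :=
  [set x | exists i b' r p p', [/\ rho0 (beta i) b' <= dC,
    is_proj (C (beta i)) r p, is_proj (C b') r p' & x = l2norm (p - p')]].

End problem.

Section probability.
Context d (Omega : measurableType d) (R : realType) (P : probability Omega R).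

(* The law of X has a density proportional to f; taking A = setT shows that
   the constant a is the inverse of the integral of f. *)
Definition density_proportional_to T
    (X : {RV P >-> T.-tuple (measurableTypeR R)})
    (f : T.-tuple (measurableTypeR R) -> R) : Prop :=
  exists2 a : R, 0 < a & forall A, measurable A ->
    distribution P X A = (a%:E * \int[lebesgue_tuple R T]_(x in A) (f x)%:E)%E.

Definition mutually_independent d' (E : measurableType d') (D : set nat)
    (X : nat -> {RV P >-> E}) : Prop :=
  forall (J : {fset nat}) (B : nat -> set E), [set` J] `<=` D ->
    (forall k, measurable (B k)) ->
    (P (\bigcap_(k in [set` J]) X k @^-1` B k) =
     \prod_(k <- J) P (X k @^-1` B k))%E.

End probability.

Definition row_of_tuple (R : realType) T
    (t : T.-tuple (measurableTypeR R)) : 'rV[R]_T :=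
  \row_(j < T) (tnth t j : R).

Section algorithm.
Variables (R : realType) (n T K : nat).

(* w_1 = 0, and w_2, ..., w_K are independent draws. *)
Definition dp_noise d (Omega : measurableType d) (P : probability Omega R)
    (b : R) (w : nat -> {RV P >-> T.-tuple (measurableTypeR R)}) : Prop :=
  [/\ forall o, row_of_tuple (w 1%N o) = 0,
      forall k, (2 <= k <= K)%N ->
        density_proportional_to (w k)
          (fun x => expR (- (b * l2norm (row_of_tuple x)))) &
      mutually_independent [set k | (2 <= k <= K)%N] w].

Definition theta (eta : R) (k : nat) : R := (eta + 1) / (eta + k%:R).

(* One execution, from the initial point r0 and for a given realization w of
   the noise: r k i and rhat k i are the iterates of index k, 1 <= k <= K.+1. *)
Definition dp_run (U : 'rV[R]_T -> R) (C : 'I_n -> set 'rV[R]_T)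
    (alpha : nat -> R) (eta : R) (r0 : 'I_n -> 'rV[R]_T) (w : nat -> 'rV[R]_T)
    (r rhat : nat -> 'I_n -> 'rV[R]_T) : Prop :=
  [/\ forall i, r 1%N i = r0 i,
      forall i, rhat 1%N i = r 1%N i,
      forall k, (1 <= k <= K)%N ->
        let p := gradient U (\sum_(i < n) r k i) + w k in
        forall i, is_proj (C i) (r k i - alpha k *: p) (r k.+1 i) &
      forall k, (1 <= k <= K)%N -> forall i,
        rhat k.+1 i = (1 - theta eta k) *: rhat k i + theta eta k *: r k.+1 i].

End algorithm.

(* Main.v *)
Require Import Defs.
From HB Require Import structures.
From mathcomp Require Import all_boot all_order all_algebra finmap.
From mathcomp Require Import all_classical all_reals all_analysis.
From mathcomp Require Import measurable_realfun zify ring lra.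
Set Implicit Arguments.
Unset Strict Implicit.
Unset Printing Implicit Defensive.
Import Order.TTheory GRing.Theory Num.Theory.
Import numFieldNormedType.Exports.
Local Open Scope classical_set_scope.
Local Open Scope ring_scope.

(** The algorithm is stochastic projected gradient descent, and the theorem is its
    usual convergence rate. Let [x] be feasible, [D = 2 rho] (a bound for the
    diameter of the feasible set in the product space), and let [sg ^+ 2] bound the
    second moment of the norm of the noise.

    Along every path, projections do not increase distances and [U] lies above its
    tangents, so the gap [U (sum r_k) - U (sum x)] is at most
    [(d_k - d_(k+1)) / (2 alpha_k)], where [d_k] is the squared distance from [r_k]
    to [x], plus an error: [alpha_k n (G ^+ 2 + |w_k| ^+ 2)] and a term linear in
    [w_k] ([descent_step]). The weights [theta_k] make the distances telescope in
    spite of the decreasing step sizes ([averaged_descent]) and preserve errors of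
    order [1 / sqrt k] ([weighted_avg_step]). The iterate [r_k] is a function of
    the draws before [w_k] ([run_past_measurable]), hence independent of [w_k],
    whose law is symmetric; the linear term has mean zero
    ([integral_past_noise]). This is what gains the factor [1 / sqrt K] on the noise
    as well as on [G]. Altogether ([run_expected_gap_le]) the expected gap is, up
    to constants, at most
    [eta (D ^+ 2 / c + c n (G ^+ 2 + sg ^+ 2) + G sqrt n D) / sqrt K],
    and [c = D / (sqrt n (G + sg))] balances the first two terms.

    It remains to find [sg] for the density proportional to [expR (- b |w|)] on
    [R^T]. The change of variables [w -> s w] of the Lebesgue measure gives the
    exponential moments of the norm ([expectation_density_ratio]), and one of them
    yields [sg = 4 T / b] ([noise_second_moment]); with
    [b = 2 eps / (K (K - 1) L Delta)], [sg / sqrt K] has the order claimed.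

    Two points need care. The sets need not be closed, so projections and minimizers
    may fail to exist: measurability of the iterates is deduced from the fact that
    projections that do exist are nonexpansive ([measurable_lipschitz]), and the
    gap is compared with feasible points of almost optimal value. The initial point
    is arbitrary, even after the step size is fixed, but [theta_1 = 1] removes it
    from the averages. *)

(** * Euclidean geometry of row vectors *)

Section dot_product.
Variables (R : realType) (T : nat).
Implicit Types (u v w x y p : 'rV[R]_T) (a : R) (C : set 'rV[R]_T).

Definition dot u v : R := \sum_(j < T) u 0 j * v 0 j.

Lemma dotC u v : dot u v = dot v u.
Proof. by apply: eq_bigr => j _; rewrite mulrC. Qed.

Lemma dotDl u v w : dot (u + v) w = dot u w + dot v w.
Proof. by rewrite -big_split; apply: eq_bigr => j _; rewrite mxE mulrDl. Qed.

Lemma dotNl u w : dot (- u) w = - dot u w.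
Proof. by rewrite -sumrN; apply: eq_bigr => j _; rewrite mxE mulNr. Qed.

Lemma dotZl a u w : dot (a *: u) w = a * dot u w.
Proof. by rewrite mulr_sumr; apply: eq_bigr => j _; rewrite mxE mulrA. Qed.

Lemma dotDr u v w : dot u (v + w) = dot u v + dot u w.
Proof. by rewrite dotC dotDl !(dotC u). Qed.

Lemma dotNr u w : dot u (- w) = - dot u w.
Proof. by rewrite dotC dotNl (dotC u). Qed.

Lemma dotZr a u w : dot u (a *: w) = a * dot u w.
Proof. by rewrite dotC dotZl (dotC u). Qed.

Lemma dot0l u : dot 0 u = 0.
Proof. by rewrite -(scale0r u) dotZl mul0r. Qed.

Definition dotE := (dotDl, dotDr, dotNl, dotNr, dotZl, dotZr).

Lemma dot_sumr (I : finType) u (f : I -> 'rV[R]_T) :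
  dot u (\sum_i f i) = \sum_i dot u (f i).
Proof.
rewrite exchange_big; apply: eq_bigr => j _.
by rewrite summxE mulr_sumr.
Qed.

Lemma dotvv_ge0 u : 0 <= dot u u.
Proof. by apply: sumr_ge0 => j _; rewrite -expr2 sqr_ge0. Qed.

Lemma l2norm_ge0 u : 0 <= l2norm u.
Proof. exact: sqrtr_ge0. Qed.

Lemma l2norm_sqr u : l2norm u ^+ 2 = dot u u.
Proof.
rewrite sqr_sqrtr; last by apply: sumr_ge0 => j _; rewrite sqr_ge0.
by apply: eq_bigr => j _; rewrite expr2.
Qed.

Lemma l2norm_le u a : 0 <= a -> dot u u <= a ^+ 2 -> l2norm u <= a.
Proof. by move=> a0; rewrite -l2norm_sqr ler_pXn2r// ?nnegrE ?l2norm_ge0. Qed.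

Lemma l2norm_le_dot u v : dot u u <= dot v v -> l2norm u <= l2norm v.
Proof. by move=> uv; rewrite l2norm_le ?l2norm_ge0 ?l2norm_sqr. Qed.

Lemma coord_le_l2norm u j : `|u 0 j| <= l2norm u.
Proof.
rewrite -sqrtr_sqr ler_sqrt; last by apply: sumr_ge0 => i _; rewrite sqr_ge0.
by rewrite (bigD1 j)//= lerDl sumr_ge0// => i _; rewrite sqr_ge0.
Qed.

Lemma dotvv_eq0 u : dot u u = 0 -> u = 0.
Proof.
move=> u0; apply/rowP => j; rewrite mxE.
have := coord_le_l2norm u j.
rewrite (_ : l2norm u = 0); first by rewrite normr_le0 => /eqP.
by apply/eqP; rewrite -sqrf_eq0 l2norm_sqr u0.
Qed.

Lemma cauchy_schwarz u v : dot u v <= l2norm u * l2norm v.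
Proof.
have [u0|u0] := eqVneq (l2norm u) 0.
  have /dotvv_eq0 u00 : dot u u = 0 by rewrite -l2norm_sqr u0 expr0n.
  by rewrite u0 mul0r u00 dot0l.
have [v0|v0] := eqVneq (l2norm v) 0.
  have /dotvv_eq0 v00 : dot v v = 0 by rewrite -l2norm_sqr v0 expr0n.
  by rewrite v0 mulr0 v00 dotC dot0l.
have up : 0 < l2norm u by rewrite lt_neqAle eq_sym u0 l2norm_ge0.
have vp : 0 < l2norm v by rewrite lt_neqAle eq_sym v0 l2norm_ge0.
have := dotvv_ge0 (l2norm v *: u - l2norm u *: v).
rewrite !dotE -!l2norm_sqr (dotC v u).
set a := l2norm u; set b := l2norm v; set s := dot u v => h.
have : 0 <= (2 * (a * b)) * (a * b - s) by lra.
by rewrite pmulr_rge0 ?subr_ge0// !mulr_gt0.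
Qed.

Lemma dotvvD_le u v : dot (u + v) (u + v) <= 2 * (dot u u + dot v v).
Proof. by have := dotvv_ge0 (u - v); rewrite !dotE (dotC v u); lra. Qed.

Lemma convex_set_comb C x y a : convex_set C -> C x -> C y -> 0 <= a <= 1 ->
  C (a *: x + (1 - a) *: y).
Proof.
move=> cC Cx Cy /andP[a0 a1].
have := cC x y (Itv01 a0 a1) (mem_set Cx) (mem_set Cy).
by rewrite inE.
Qed.

(** Moving from the projection [p] a short way towards [y] stays in [C] and
    cannot come closer to [x]; the first order term in the step length gives
    the obtuse angle. *)
Lemma proj_obtuse C x p y : convex_set C -> is_proj C x p -> C y ->
  dot (x - p) (y - p) <= 0.
Proof.
move=> cC [Cp pmin] Cy.
rewrite leNgt; apply/negP; set m := dot _ _ => m0.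
pose N := dot (y - p) (y - p); have N0 : 0 <= N := dotvv_ge0 _.
pose t := m / (m + N).
have mN : 0 < m + N by lra.
have t0 : 0 < t by rewrite divr_gt0.
have t1 : t <= 1 by rewrite ler_pdivrMr// mul1r; lra.
have tN : t * N <= m.
  by rewrite /t mulrAC ler_pdivrMr// ler_pM2l// lerDr ltW.
have Cz : C (p + t *: (y - p)).
  rewrite (_ : _ + _ = t *: y + (1 - t) *: p); last first.
    by rewrite scalerBl scale1r scalerBr addrCA addrA.
  by apply: convex_set_comb => //; rewrite ltW.
have := pmin _ Cz.
rewrite !l2norm_sqr (_ : p + t *: (y - p) - x = t *: (y - p) - (x - p)); last first.
  by rewrite opprB [RHS]addrCA addrA.
rewrite -(opprB x p) dotNl dotNr opprK.
rewrite !(dotDl (t *: _)) !(dotDr _ (t *: _)) !dotNl !dotNr !dotZl !dotZr.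
rewrite (dotC (y - p) (x - p)) -/m -/N => h.
have : t * (2 * m - t * N) <= 0 by lra.
by rewrite pmulr_rle0//; lra.
Qed.

Lemma proj_closer C x p y : convex_set C -> is_proj C x p -> C y ->
  dot (p - y) (p - y) <= dot (x - y) (x - y).
Proof.
move=> cC pC Cy; have := proj_obtuse cC pC Cy.
have := dotvv_ge0 (x - p); rewrite !dotE (dotC p x) (dotC y x) (dotC y p); lra.
Qed.

(** The two obtuse angle inequalities add up to
    [|p - p'|^2 <= <x - x', p - p'>], and Cauchy-Schwarz does the rest. *)
Lemma proj_nonexpansive C x x' p p' : convex_set C ->
  is_proj C x p -> is_proj C x' p' -> l2norm (p - p') <= l2norm (x - x').
Proof.
move=> cC pC pC'; have [Cp _] := pC; have [Cp' _] := pC'.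
have h1 := proj_obtuse cC pC Cp'; have h2 := proj_obtuse cC pC' Cp.
have h : dot (p - p') (p - p') <= dot (x - x') (p - p').
  move: h1 h2; rewrite !dotE; lra.
apply: l2norm_le_dot; have := dotvv_ge0 ((x - x') - (p - p')).
rewrite (dotDl (x - x')) !(dotDr _ (x - x')) !dotNl !dotNr.
by rewrite (dotC (p - p') (x - x')); lra.
Qed.

Lemma proj_unique C x p p' : convex_set C ->
  is_proj C x p -> is_proj C x p' -> p = p'.
Proof.
move=> cC pC pC'; apply/subr0_eq/dotvv_eq0.
have := proj_nonexpansive cC pC pC'.
rewrite subrr (_ : l2norm (0 : 'rV[R]_T) = 0); last first.
  by apply/eqP; rewrite -sqrf_eq0 l2norm_sqr dot0l.
rewrite -l2norm_sqr => h.
suff -> : l2norm (p - p') = 0 by rewrite expr0n.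
by apply/eqP; rewrite eq_le h l2norm_ge0.
Qed.

End dot_product.

(** * Convex differentiable functions *)

Section convex_gradient.
Variables (R : realType) (T : nat) (U : 'rV[R]_T -> R).
Hypothesis cU : convex_function setT U.
Hypothesis dU : forall x, differentiable U x.

Lemma derive_gradient x v : 'D_v U x = dot (gradient U x) v.
Proof.
rewrite deriveE//.
rewrite {1}(row_sum_delta v) linear_sum; apply: eq_bigr => j _.
by rewrite linearZ /= -deriveE// mxE [RHS]mulrC.
Qed.

Lemma convex_comb x y (t : R) : 0 <= t <= 1 ->
  U (t *: x + (1 - t) *: y) <= t * U x + (1 - t) * U y.
Proof.
move=> /andP[t0 t1].
have := @cU (Itv01 t0 t1) x y (mem_set I) (mem_set I).
by [].
Qed.

(** By convexity the difference quotients towards [y] are at most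
    [U y - U x]; so is their limit. *)
Lemma convex_first_order x y : U x + dot (gradient U x) (y - x) <= U y.
Proof.
rewrite -derive_gradient -lerBrDl.
have h : derivable U x (y - x) by exact: diff_derivable.
pose q (t : R) : R := t^-1 * (U (t *: (y - x) + x) - U x).
have cq : q t @[t --> 0^'+] --> 'D_(y - x) U x.
  apply: cvg_trans h; apply: cvg_app.
  move=> A [e egt0 Ae]; exists e => // z ze zgt0; apply: Ae => //.
  exact/lt0r_neq0.
rewrite -(cvg_lim (@Rhausdorff R) cq).
apply: limr_le; first by apply/cvg_ex; exists ('D_(y - x) U x).
near=> t.
have t0 : 0 < t by [].
have t1 : t <= 1 by near: t; apply: nbhs_right_le.
rewrite /q mulrC ler_pdivrMr// (mulrC _ t).
have := @convex_comb y x t; rewrite t1 ltW// => /(_ isT).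
rewrite (_ : t *: y + _ = t *: (y - x) + x); first lra.
by rewrite scalerBl scalerBr scale1r -!addrA (addrC x).
Unshelve. all: by end_near. Qed.

End convex_gradient.

(** * Feasible points and the descent inequality *)

Section problem_geometry.
Variables (R : realType) (n T : nat).
Implicit Types (U : 'rV[R]_T -> R) (C : 'I_n -> set 'rV[R]_T).
Implicit Types (r x a : 'I_n -> 'rV[R]_T).

Definition dist2 r x : R := \sum_i dot (r i - x i) (r i - x i).

Lemma dist2_ge0 r x : 0 <= dist2 r x.
Proof. by apply: sumr_ge0 => i _; exact: dotvv_ge0. Qed.

(** Cauchy-Schwarz between the [n] terms. *)
Lemma dot_sum_le a :
  dot (\sum_i a i) (\sum_i a i) <= n%:R * \sum_i dot (a i) (a i).
Proof.
rewrite dot_sumr.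
have -> : \sum_i dot (\sum_j a j) (a i) = \sum_i \sum_j dot (a i) (a j).
  by apply: eq_bigr => i _; rewrite dotC dot_sumr.
apply: (@le_trans _ _ (\sum_i \sum_j (dot (a i) (a i) + dot (a j) (a j)) / 2)).
  apply: ler_sum => i _; apply: ler_sum => j _.
  by have := dotvv_ge0 (a i - a j); rewrite !dotE (dotC (a j) (a i)); lra.
under eq_bigr do under eq_bigr do rewrite mulrDl.
under eq_bigr do rewrite big_split /= sumr_const card_ord.
rewrite big_split /= sumr_const card_ord sumrMnl -mulr_suml.
rewrite -mulrnDl -mulrDl -mulr_natl; lra.
Qed.

Section bounds.
Variables (U : 'rV[R]_T -> R) (C : 'I_n -> set 'rV[R]_T) (L : R).
Hypothesis cU : convex_function setT U.
Hypothesis dU : forall y, differentiable U y.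
Hypothesis LU : lipschitz_gradient U L.
Hypothesis C0 : forall i, C i !=set0.
Hypothesis Cb : has_ubound (norms C).

Let rho := sup (norms C).
Let G := sup (gradient_norms U C).

Lemma feasible_nonempty : feasible C !=set0.
Proof. by have [x Cx] := choice C0; exists x. Qed.

Lemma norm_feasible_le r : feasible C r -> \sum_i dot (r i) (r i) <= rho ^+ 2.
Proof.
move=> Cr; under eq_bigr do rewrite -l2norm_sqr.
set S := \sum_i _; have S0 : 0 <= S by apply: sumr_ge0 => i _; rewrite sqr_ge0.
have h : Num.sqrt S <= rho by apply: ub_le_sup => //; exists r.
rewrite -(sqr_sqrtr S0) ler_pXn2r// nnegrE ?sqrtr_ge0//.
exact: le_trans h.
Qed.

Lemma radius_ge0 : 0 <= rho.
Proof.
have [x Cx] := feasible_nonempty.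
by apply: le_trans (sqrtr_ge0 _) _; apply: ub_le_sup => //; exists x.
Qed.

Lemma dist2_feasible_le r x : feasible C r -> feasible C x ->
  dist2 r x <= (2 * rho) ^+ 2.
Proof.
move=> /norm_feasible_le hr /norm_feasible_le hx.
apply: (@le_trans _ _ (2 * (\sum_i dot (r i) (r i) + \sum_i dot (x i) (x i)))).
  rewrite -big_split mulr_sumr; apply: ler_sum => i _.
  by have := dotvvD_le (r i) (- x i); rewrite !dotNl !dotNr opprK.
by rewrite exprMn; lra.
Qed.

Lemma norm_sumB_le r x : feasible C r -> feasible C x ->
  l2norm (\sum_i r i - \sum_i x i) <= Num.sqrt n%:R * (2 * rho).
Proof.
move=> Cr Cx; apply: l2norm_le; first by rewrite !mulr_ge0 ?sqrtr_ge0// radius_ge0.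
rewrite exprMn sqr_sqrtr ?ler0n// -sumrB.
apply: le_trans (dot_sum_le _) _; apply: ler_wpM2l => //.
exact: dist2_feasible_le.
Qed.

(** A Lipschitz gradient is bounded on a bounded set. As [sup] is a default
    value on unbounded sets, this is what makes [G] a bound. *)
Lemma gradient_norms_ubound : has_ubound (gradient_norms U C).
Proof.
have [x Cx] := feasible_nonempty.
pose N := dot (gradient U (\sum_i x i)) (gradient U (\sum_i x i)).
exists (Num.sqrt (2 * ((L * (Num.sqrt n%:R * (2 * rho))) ^+ 2 + N))).
move=> _ [r Cr <-].
have N0 : 0 <= N := dotvv_ge0 _.
apply: l2norm_le; first exact: sqrtr_ge0.
rewrite sqr_sqrtr; last by rewrite mulr_ge0// addr_ge0// sqr_ge0.
rewrite -{1 2}(subrK (gradient U (\sum_i x i)) (gradient U (\sum_i r i))).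
apply: le_trans (dotvvD_le _ _) _.
rewrite ler_pM2l// lerD2r -l2norm_sqr.
have LD : l2norm (gradient U (\sum_i r i) - gradient U (\sum_i x i)) <=
  `|L| * (Num.sqrt n%:R * (2 * rho)).
  apply: le_trans (LU _ _) _.
  apply: (@le_trans _ _ (`|L| * l2norm (\sum_i r i - \sum_i x i))).
    by apply: ler_wpM2r; [exact: l2norm_ge0|exact: ler_norm].
  by apply: ler_wpM2l => //; exact: norm_sumB_le.
rewrite exprMn -(real_normK (num_real L)) -exprMn.
by rewrite ler_pXn2r ?nnegrE ?l2norm_ge0// (le_trans _ LD)// l2norm_ge0.
Qed.

Lemma gradient_feasible_le r : feasible C r ->
  l2norm (gradient U (\sum_i r i)) <= G.
Proof. by move=> Cr; apply: ub_le_sup gradient_norms_ubound _ _; exists r. Qed.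

Lemma gradient_bound_ge0 : 0 <= G.
Proof.
have [x Cx] := feasible_nonempty.
exact: le_trans (l2norm_ge0 _) (gradient_feasible_le Cx).
Qed.

Lemma gap_le r x : feasible C r -> feasible C x ->
  U (\sum_i r i) - U (\sum_i x i) <= G * (Num.sqrt n%:R * (2 * rho)).
Proof.
move=> Cr Cx; have h := convex_first_order cU dU (\sum_i r i) (\sum_i x i).
apply: (@le_trans _ _ (dot (gradient U (\sum_i r i)) (\sum_i r i - \sum_i x i))).
  by move: h; rewrite !dotDr !dotNr; lra.
apply: le_trans (cauchy_schwarz _ _) _.
by apply: ler_pM; rewrite ?l2norm_ge0 ?gradient_feasible_le ?norm_sumB_le.
Qed.

Let values_inf : has_inf [set U (\sum_(i < n) r i) | r in feasible C].
Proof.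
have [x Cx] := feasible_nonempty; split; first by exists (U (\sum_i x i)), x.
exists (U (\sum_i x i) - G * (Num.sqrt n%:R * (2 * rho))) => _ [r Cr <-].
by have := gap_le Cx Cr; lra.
Qed.

Lemma optimal_value_le x : feasible C x -> optimal_value U C <= U (\sum_i x i).
Proof. by move=> Cx; apply: ge_inf; [case: values_inf|exists x]. Qed.

Lemma optimal_value_approx (e : R) : 0 < e ->
  exists2 x, feasible C x & U (\sum_i x i) < optimal_value U C + e.
Proof.
by move=> e0; have [_ [x Cx <-] ?] := inf_adherent e0 values_inf; exists x.
Qed.

(** One step of projected gradient descent with the perturbed gradient [g + w].
    Projection does not increase the distance to [x], and expanding the squared
    distance of the unprojected step leaves [w] in a term that is linear in [w]
    and in a term that is quadratic in it. *)
Lemma descent_step r r' x w (alpha : R) : (forall i, convex_set (C i)) ->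
  feasible C r -> feasible C x -> 0 < alpha ->
  (forall i, is_proj (C i) (r i - alpha *: (gradient U (\sum_j r j) + w)) (r' i)) ->
  U (\sum_i r i) - U (\sum_i x i) <=
  (2 * alpha)^-1 * (dist2 r x - dist2 r' x)
  + (alpha * n%:R * (G ^+ 2 + dot w w) + dot w (\sum_i x i - \sum_i r i)).
Proof.
move=> cC Cr Cx a0 Pr'.
set g := gradient U _ in Pr' *.
have gG : dot g g <= G ^+ 2.
  rewrite -l2norm_sqr ler_pXn2r// ?nnegrE ?l2norm_ge0 ?gradient_bound_ge0//.
  exact: gradient_feasible_le.
have h := convex_first_order cU dU (\sum_i r i) (\sum_i x i).
rewrite -/g in h.
pose p := g + w.
have pp : dot p p <= 2 * (G ^+ 2 + dot w w).
  by apply: le_trans (dotvvD_le _ _) _; lra.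
have key : dist2 r' x <= dist2 r x - 2 * alpha * dot p (\sum_i r i - \sum_i x i)
    + alpha ^+ 2 * n%:R * dot p p.
  have -> : alpha ^+ 2 * n%:R * dot p p = \sum_(i < n) alpha ^+ 2 * dot p p.
    by rewrite sumr_const card_ord -mulr_natl; ring.
  rewrite -sumrB dot_sumr mulr_sumr -sumrB -big_split /=.
  apply: ler_sum => i _.
  apply: le_trans (proj_closer (cC i) (Pr' i) (Cx i)) _.
  rewrite -/p addrAC; move: {pp} p (r i - x i) => p' v.
  by rewrite !dotE (dotC v p'); lra.
have a2 : (2 * alpha) * (2 * alpha)^-1 = 1 by rewrite divff// lt0r_neq0//; lra.
have key2 : dot p (\sum_i r i - \sum_i x i) <=
    (2 * alpha)^-1 * (dist2 r x - dist2 r' x) + alpha * n%:R * (G ^+ 2 + dot w w).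
  rewrite -(ler_pM2l (_ : 0 < 2 * alpha)); last lra.
  rewrite mulrDr [X in _ <= X + _]mulrA a2 mul1r.
  have an : 0 <= alpha ^+ 2 * n%:R by rewrite mulr_ge0// sqr_ge0.
  have := ler_wpM2l an pp.
  lra.
move: h key2; rewrite /p !dotDl !dotDr !dotNr; lra.
Qed.

End bounds.

Lemma feasible_comb C r x (a : R) : (forall i, convex_set (C i)) ->
  feasible C r -> feasible C x -> 0 <= a <= 1 ->
  feasible C (fun i => (1 - a) *: r i + a *: x i).
Proof.
move=> cC Cr Cx a01 i; rewrite addrC; exact: convex_set_comb.
Qed.

End problem_geometry.

(** * The polynomially weighted average *)

Section weighted_average.
Variables (R : realType) (eta : R).

Lemma theta_ge0 k : 1 <= eta -> 0 <= theta eta k.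
Proof.
move=> eta1; have k0 : 0 <= k%:R :> R by [].
by rewrite /theta divr_ge0//; lra.
Qed.

Lemma onem_theta k : 1 <= eta -> (0 < k)%N -> 1 - theta eta k = k.-1%:R / (eta + k%:R).
Proof.
move=> eta1; case: k => // k _; rewrite /theta -natr1 /=.
have k0 : 0 <= k%:R :> R by [].
have : eta + (k%:R + 1) != 0 by apply: lt0r_neq0; lra.
by move=> ?; field.
Qed.

Lemma theta_le1 k : 1 <= eta -> (0 < k)%N -> theta eta k <= 1.
Proof.
move=> eta1 k0; rewrite -subr_ge0 onem_theta// divr_ge0//.
by have k0' : 0 <= k%:R :> R by []; lra.
Qed.

Lemma theta1 : 1 <= eta -> theta eta 1 = 1.
Proof. by move=> eta1; rewrite /theta divff//; apply: lt0r_neq0; lra. Qed.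

Lemma theta_le k : 1 <= eta -> (0 < k)%N -> theta eta k <= 2 * eta / k.+1%:R.
Proof.
move=> eta1 k0; have k0' : 0 <= k%:R :> R by [].
rewrite /theta -natr1 ler_pdivrMr; last lra.
rewrite mulrAC ler_pdivlMr; last lra.
nra.
Qed.

(** The weights are those with which the averaged iterate of index [m.+1]
    combines the iterates of index [2], ..., [m.+1]: the first iterate is
    forgotten because [theta eta 1 = 1]. *)
Fixpoint weighted_avg (e : nat -> R) m : R :=
  if m is m'.+1 then (1 - theta eta m) * weighted_avg e m' + theta eta m * e m.+1
  else 0.

(** [h] and [f] stand for the gaps of the averaged and of the plain iterates,
    [d] for the squared distances to a reference point. The weighted step
    lengths are such that [(k - 1) / (eta + k - 1) * sqrt k <= sqrt (k + 1)];
    hence the term [D2 - d] inherited from one index is absorbed by the one of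
    the next index, and the distances telescope although the step sizes vary. *)
Lemma averaged_descent (c D2 : R) (h f d e : nat -> R) N :
  1 <= eta -> 0 < c ->
  (forall k, (2 <= k <= N.+1)%N -> d k <= D2) ->
  (forall k, (1 <= k <= N)%N ->
     h k.+1 <= (1 - theta eta k) * h k + theta eta k * f k.+1) ->
  (forall k, (2 <= k <= N)%N ->
     f k <= Num.sqrt k%:R / (2 * c) * (d k - d k.+1) + e k) ->
  forall m, (m.+2 <= N)%N ->
  h m.+2 <= theta eta m.+1 * (Num.sqrt m.+2%:R / (2 * c)) * (D2 - d m.+3)
            + weighted_avg e m.+1.
Proof.
move=> eta1 c0 dD hf fd; 
have step t u x2 x3 d3 d4 h2 h3 f3 a e3 : 0 <= t <= 1 ->
    (1 - t) * u * x2 <= t * x3 -> d3 <= D2 -> h2 <= u * x2 * (D2 - d3) + a ->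
    f3 <= x3 * (d3 - d4) + e3 -> h3 <= (1 - t) * h2 + t * f3 ->
    h3 <= t * x3 * (D2 - d4) + ((1 - t) * a + t * e3).
  move=> /andP[t0 t1] key dd hi ff hh.
  have := ler_wpM2l t0 ff.
  have t1' : 0 <= 1 - t by lra.
  have := ler_wpM2l t1' hi.
  have dd' : 0 <= D2 - d3 by lra.
  have := ler_wpM2r dd' key.
  lra.
elim=> [|m IH] mN.
  have := hf 1%N; rewrite (ltnW mN) => /(_ isT).
  have := fd 2%N; rewrite mN => /(_ isT).
  have d2 : d 2%N <= D2 by apply: dD; exact: ltnW mN.
  rewrite /= !theta1// subrr !mul0r !mul1r !add0r.
  have : 0 <= Num.sqrt 2%:R / (2 * c) by rewrite divr_ge0 ?sqrtr_ge0//; lra.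
  set s := Num.sqrt _ / _ => s0 f2 h2.
  by have := ler_wpM2l s0 d2; lra.
have t0 := theta_ge0 m.+2 eta1; have t1 := theta_le1 eta1 (ltn0Sn m.+1).
set t := theta eta m.+2; set u := theta eta m.+1.
have key : (1 - t) * u * Num.sqrt m.+2%:R <= t * Num.sqrt m.+3%:R.
  rewrite /t /u onem_theta// /theta /=.
  have m0 : 0 <= m%:R :> R by [].
  have se : Num.sqrt m.+2%:R <= Num.sqrt m.+3%:R :> R.
    by rewrite ler_sqrt ?ler0n// ler_nat.
  have s0 : 0 <= Num.sqrt m.+2%:R :> R := sqrtr_ge0 _.
  have e1 : 0 < eta + m.+1%:R by rewrite -natr1; lra.
  have e2 : 0 < eta + m.+2%:R by rewrite -!natr1; lra.
  move: se s0 e2; set s2 := Num.sqrt _; set s3 := Num.sqrt _.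
  set b := eta + m.+2%:R => se s0 e2.
  rewrite [leLHS](_ : _ = ((eta + 1) / b) *
      (m.+1%:R / (eta + m.+1%:R) * s2)); last by ring.
  apply: ler_wpM2l; first by rewrite divr_ge0//; lra.
  apply: le_trans se; apply: ler_piMl => //.
  by rewrite ler_pdivrMr// mul1r; lra.
have c1 : 0 <= (2 * c)^-1 by rewrite invr_ge0; lra.
apply: (step _ _ _ _ _ _ _ _ _ _ _ _ _ _ (IH (ltnW mN)) (fd m.+3 _) (hf m.+2 _)).
- exact/andP.
- by move: (ler_wpM2r c1 key); rewrite /= !mulrA.
- by apply: dD; exact: ltnW mN.
- by rewrite /= mN.
- by rewrite /= (ltnW mN).
Qed.

(** Errors of order [Q / sqrt k] have an average of the same order: passing from
    [sqrt k] to [sqrt (k + 1)] costs a factor of at most [1 + 1 / (2 k)], and the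
    factor [1 - theta eta k] is small enough to pay for it. The constant [2] is
    good for every [eta >= 1]. *)
Lemma weighted_avg_step (Q : R) k : 1 <= eta -> 0 <= Q -> (0 < k)%N ->
  (1 - theta eta k) * (2 * Q / Num.sqrt k%:R)
   + theta eta k * (Q / Num.sqrt k.+1%:R) <= 2 * Q / Num.sqrt k.+1%:R.
Proof.
move=> eta1 Q0 k0; have k1 : 1 <= k%:R :> R by rewrite ler1n.
have ek : 0 < eta + k%:R by lra.
set s := Num.sqrt k%:R; set t := Num.sqrt k.+1%:R.
have s2 : s ^+ 2 = k%:R by rewrite sqr_sqrtr// ler0n.
have t2 : t ^+ 2 = k%:R + 1 by rewrite sqr_sqrtr ?ler0n// natr1.
have s0 : 0 < s by rewrite sqrtr_gt0; lra.
have t0 : 0 < t by rewrite sqrtr_gt0 ltr0n.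
have st : 2 * k%:R * t <= (2 * k%:R + 1) * s.
  rewrite -(@ler_pXn2r _ 2)// ?nnegrE; last 2 first.
  - by rewrite !mulr_ge0//; lra.
  - by rewrite mulr_ge0//; lra.
  rewrite !exprMn s2 t2; nra.
have st' : s^-1 <= (1 + (2 * k%:R)^-1) / t.
  rewrite ler_pdivlMr// mulrC ler_pdivrMr//.
  rewrite -(ler_pM2l (_ : 0 < 2 * k%:R)); last lra.
  rewrite [leRHS]mulrA mulrDr mulr1 divff; last by apply: lt0r_neq0; lra.
  exact: st.
rewrite onem_theta// /theta.
have -> : k.-1%:R = k%:R - 1 :> R by case: (k) k0 => // j _; rewrite -natr1 addrK.
have tt : 0 < t^-1 by rewrite invr_gt0.
have kk : (k%:R - 1) * s^-1 <= (k%:R - 1 / 2) * t^-1.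
  apply: (le_trans (ler_wpM2l _ st')); first lra.
  rewrite mulrA ler_pM2r//.
  have : 0 < (2 * k%:R)^-1 :> R by rewrite invr_gt0; lra.
  have : (2 * k%:R) * (2 * k%:R)^-1 = 1 :> R by rewrite divff//; apply: lt0r_neq0; lra.
  by set z := (2 * k%:R)^-1 : R; nra.
rewrite -(ler_pM2l ek) mulrDr.
rewrite (_ : (eta + k%:R) * _ = 2 * Q * ((k%:R - 1) * s^-1)); last first.
  by field; rewrite !lt0r_neq0.
rewrite (_ : (eta + k%:R) * (_ * (Q / t)) = Q * (eta + 1) * t^-1); last first.
  by field; rewrite !lt0r_neq0.
have := ler_wpM2l (_ : 0 <= 2 * Q) kk => /(_ ltac:(lra)).
set z := t^-1 in tt *.
have := mulr_ge0 (mulr_ge0 Q0 (ltW tt)) (_ : 0 <= eta) => /(_ ltac:(lra)).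
by rewrite !mulrA; nra.
Qed.

End weighted_average.

(** * Changes of variables for the Lebesgue measure on tuples *)

Section lebesgue_scaling.
Context {R : realType}.
Local Open Scope ereal_scope.
Local Notation leb := (@lebesgue_measure R).
Local Notation tup n := (n.-tuple (measurableTypeR R)).

Lemma ge0_integral_lebesgue_tupleS n (f : tup n.+1 -> \bar R) :
  measurable_fun [set: tup n.+1] f -> (forall t, 0 <= f t) ->
  \int[lebesgue_tuple R n.+1]_t f t =
  \int[leb]_x \int[lebesgue_tuple R n]_t f (tcons (x, t)).
Proof.
move=> mf f0.
rewrite [LHS](@ge0_integral_pushforward _ _ _ _ _ _
  (measurable_tcons (n := n)) (leb \x lebesgue_tuple R n) setT f)//.
rewrite preimage_setT fubini_tonelli1//; last by move=> p; exact: f0.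
exact: measurableT_comp mf (measurable_tcons (n := n)).
Qed.

Lemma measurable_map_tuple n (phi : measurableTypeR R -> measurableTypeR R) :
  measurable_fun setT phi ->
  measurable_fun [set: tup n] (fun t : tup n => [tuple of map phi t] : tup n).
Proof.
move=> mphi; apply/measurable_fun_tnthP => i.
rewrite (_ : _ \o _ = phi \o (fun t : tup n => tnth t i)).
  exact: measurableT_comp mphi (measurable_tnth i).
by apply/funext => t /=; rewrite tnth_map.
Qed.

(** Fubini's theorem gives one factor [k] for each coordinate. The maps of
    interest are the scalings and the negation. *)
Lemma ge0_integral_lebesgue_tuple_map (k : R)
    (phi : measurableTypeR R -> measurableTypeR R) :
  (0 <= k)%R -> measurable_fun setT phi ->
  (forall A, measurable A -> pushforward leb phi A = k%:E * leb A) ->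
  forall n (f : tup n -> \bar R),
  measurable_fun [set: tup n] f -> (forall t, 0 <= f t) ->
  \int[lebesgue_tuple R n]_t f [tuple of map phi t] =
  (k ^+ n)%:E * \int[lebesgue_tuple R n]_t f t.
Proof.
move=> k0 mphi lphi.
have lphi1 (g : measurableTypeR R -> \bar R) : measurable_fun setT g ->
    (forall x, 0 <= g x) -> \int[leb]_x g (phi x) = k%:E * \int[leb]_x g x.
  move=> mg g0.
  transitivity (\int[pushforward leb phi]_x g x).
    by rewrite (ge0_integral_pushforward mphi)// preimage_setT.
  rewrite -(@ge0_integral_mscale _ _ _ leb setT measurableT (NngNum k0))//.
  by apply: eq_measure_integral => A mA _; exact: lphi.
elim=> [|n IH] f mf f0.
  rewrite /= !integral_dirac//; last exact: measurableT_comp mf (measurable_map_tuple mphi).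
  rewrite !diracT expr0 !mul1e; congr f; exact: tuple0.
pose F x := \int[lebesgue_tuple R n]_t f (tcons (x, t)).
have mft : measurable_fun setT (f \o @tcons R n).
  exact: measurableT_comp mf (measurable_tcons (n := n)).
rewrite ge0_integral_lebesgue_tupleS//; last first.
  exact: measurableT_comp mf (measurable_map_tuple mphi).
transitivity (\int[leb]_x ((k ^+ n)%:E * F (phi x))).
  apply: eq_integral => x _.
  rewrite -(IH (fun t => f (tcons (phi x, t))))//; last first.
    by apply: measurableT_comp mft _; exact: measurable_pair1.
  by apply: eq_integral => t _; congr f; exact/val_inj.
have mF : measurable_fun setT F.
  have := @measurable_fun_fubini_tonelli_F _ _ _ _ _
    (lebesgue_tuple R n) (f \o @tcons R n).
  by apply => // p; exact: f0.
have F0 x : 0 <= F x by exact: integral_ge0.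
rewrite ge0_integralZl//; last 2 first.
- exact: measurableT_comp mF mphi.
- by rewrite lee_fin exprn_ge0.
rewrite lphi1// muleA -EFinM -exprSr; congr (_ * _).
by rewrite ge0_integral_lebesgue_tupleS.
Qed.

Lemma pushforward_lebesgue_scale (s : R) : (0 < s)%R -> forall A, measurable A ->
  pushforward leb (fun x : measurableTypeR R => s * x : measurableTypeR R)%R A
  = s^-1%:E * leb A.
Proof.
move=> s0 A mA.
pose phi : measurableTypeR R -> measurableTypeR R := fun x => (s * x)%R.
rewrite -[pushforward _ _]/(pushforward leb phi).
have mphi : measurable_fun setT phi by exact: mulrl_measurable.
pose pm : {measure set (measurableTypeR R) -> \bar R} :=
  measure_function_pushforward__canonical__measure_function_Measure leb mphi.
have -> : leb A = s%:E * pushforward leb phi A.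
  apply: (@lebesgue_measure_unique _
    (mscale (NngNum (ltW s0)) pm)) => //.
  move=> _ [[a b]] _ <-.
  rewrite -[RHS]/(s%:E * leb (phi @^-1` `]a, b])).
  have -> : phi @^-1` `]a, b] = `](a / s)%R, (b / s)%R]%classic.
    by apply/seteqP; split => x /=;
      rewrite !in_itv/= ltr_pdivrMr// ler_pdivlMr// (mulrC x).
  rewrite !lebesgue_measure_itv/= !lte_fin ltr_pM2r ?invr_gt0//.
  case: ifPn => _; last by rewrite mule0.
  rewrite -!EFinB -EFinM; congr EFin.
  by rewrite -mulrBl mulrCA divff ?mulr1// lt0r_neq0.
by rewrite muleA -EFinM mulVf ?mul1e// lt0r_neq0.
Qed.

End lebesgue_scaling.

(** * Measures with a density *)

Section density.
Local Open Scope ereal_scope.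
Context d (X : measurableType d) (R : realType).
Variables (nu mu : {measure set X -> \bar R}) (g : X -> R).
Hypothesis mg : measurable_fun setT g.
Hypothesis g0 : forall x, (0 <= g x)%R.
Hypothesis nuE : forall A, measurable A -> nu A = \int[mu]_(x in A) (g x)%:E.

Import HBNNSimple.

Let ge0_integral_density_nnsfun (h : {nnsfun X >-> R}) :
  \int[nu]_x (h x)%:E = \int[mu]_x ((h x)%:E * (g x)%:E).
Proof.
transitivity (\int[nu]_x (\sum_(y \in range h) (y * \1_(h @^-1` [set y]) x)%:E)).
  by apply: eq_integral => x _; rewrite fimfunE -fsumEFin.
rewrite ge0_integral_fsum//; last 2 first.
- by move=> y; apply/measurable_EFinP; exact: measurable_funM.
- by move=> y x _; exact: nnfun_muleindic_ge0.
transitivity (\int[mu]_x (\sum_(y \in range h)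
    ((y * \1_(h @^-1` [set y]) x)%:E * (g x)%:E))); last first.
  apply: eq_integral => x _; rewrite -ge0_mule_fsuml; last first.
    by move=> y; exact: nnfun_muleindic_ge0.
  by rewrite fsumEFin// -fimfunE.
rewrite ge0_integral_fsum//; last 2 first.
- move=> y; apply: emeasurable_funM; last exact/measurable_EFinP.
  by apply/measurable_EFinP; exact: measurable_funM.
- by move=> y x _; apply: mule_ge0; [exact: nnfun_muleindic_ge0|rewrite lee_fin].
apply: eq_fsbigr => y /[!inE] -[x0 _ hy].
have y0 : (0 <= y)%R by rewrite -hy.
have mhy : measurable (h @^-1` [set y]) by [].
under eq_integral do rewrite EFinM.
under [RHS]eq_integral do rewrite EFinM -muleA.
rewrite !ge0_integralZl//; last 3 first.
- apply: emeasurable_funM; last exact/measurable_EFinP.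
  exact/measurable_EFinP.
- by move=> x _; rewrite mule_ge0 ?lee_fin.
- by apply/measurable_EFinP.
rewrite integral_indic// setIT nuE//; congr (_ * _).
rewrite integral_mkcond; apply: eq_integral => x _.
by rewrite epatch_indic muleC.
Qed.

Lemma ge0_integral_density (f : X -> \bar R) : measurable_fun setT f ->
  (forall x, 0 <= f x) -> \int[nu]_x f x = \int[mu]_x (f x * (g x)%:E).
Proof.
move=> mf f0; pose h := nnsfun_approx measurableT mf.
have fE x : f x = lim ((h n x)%:E @[n --> \oo]).
  by apply/esym/cvg_lim => //; exact: cvg_nnsfun_approx.
have nd x : nondecreasing_seq (fun n => (h n x)%:E).
  by move=> p q pq; rewrite lee_fin; exact/lefP/nd_nnsfun_approx.
have -> : \int[nu]_x f x = lim (\int[nu]_x (h n x)%:E @[n --> \oo]).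
  under eq_integral do rewrite fE.
  apply: monotone_convergence => //.
  - by move=> n; exact/measurable_EFinP.
  - by move=> n x _; rewrite lee_fin.
have -> : \int[mu]_x (f x * (g x)%:E) =
    lim (\int[mu]_x ((h n x)%:E * (g x)%:E) @[n --> \oo]).
  transitivity (\int[mu]_x lim (((h n x)%:E * (g x)%:E) @[n --> \oo])).
    apply: eq_integral => x _; apply/esym/cvg_lim => //.
    by apply: cvgeZr => //; exact: cvg_nnsfun_approx.
  apply: monotone_convergence => //.
  - by move=> n; apply: emeasurable_funM; exact/measurable_EFinP.
  - by move=> n x _; rewrite mule_ge0// lee_fin.
  - by move=> x _ p q pq; apply: lee_wpmul2r; rewrite ?lee_fin//; exact: nd.
by under eq_fun do rewrite ge0_integral_density_nnsfun.
Qed.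

End density.

(** * The law of the noise *)

Section noise_law.
Local Open Scope ereal_scope.
Context d (Omega : measurableType d) (R : realType) (P : probability Omega R).
Variables (T : nat) (W : {RV P >-> T.-tuple (measurableTypeR R)}) (b : R).
Local Notation tup := (T.-tuple (measurableTypeR R)).
Local Notation row := (@row_of_tuple R T).
Local Notation density b := (fun x : tup => expR (- (b * l2norm (row x)))).
Hypothesis dW : density_proportional_to W (density b).

Lemma measurable_l2norm_row : measurable_fun [set: tup] (fun x => l2norm (row x)).
Proof.
have ms : measurable_fun setT (@Num.sqrt R).
  exact: (continuous_measurable_fun (@sqrt_continuous R)).
apply: (measurableT_comp ms).
apply: measurable_sum => j.
under eq_fun do rewrite mxE.
apply: measurable_funX.
exact: measurable_tnth.
Qed.

Lemma measurable_density c : measurable_fun [set: tup] (density c).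
Proof.
apply: measurableT_comp => //.
apply: measurableT_comp => //.
by apply: measurable_funM => //; exact: measurable_l2norm_row.
Qed.

Lemma row_map_scale (c : R) (t : tup) :
  row [tuple of map (fun x : measurableTypeR R => c * x : measurableTypeR R)%R t] =
  (c *: row t)%R.
Proof. by apply/rowP => j; rewrite !mxE tnth_map. Qed.

Lemma ge0_integral_law : exists2 a : R, (0 < a)%R &
  forall f : tup -> \bar R, measurable_fun [set: tup] f -> (forall x, 0 <= f x) ->
  \int[P]_o f (W o) =
  a%:E * \int[lebesgue_tuple R T]_x (f x * (density b x)%:E).
Proof.
have [a a0 aE] := dW; exists a => // f mf f0.
rewrite -(ge0_integral_distribution W)//.
rewrite -ge0_integralZl//; last 3 first.
- apply: emeasurable_funM => //; apply/measurable_EFinP.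
  exact: measurable_density.
- by move=> x _; rewrite mule_ge0// lee_fin expR_ge0.
- by rewrite lee_fin ltW.
rewrite [LHS](@ge0_integral_density _ _ _ _ (lebesgue_tuple R T) (fun x => a * density b x)%R)//.
- by apply: eq_integral => x _; rewrite EFinM muleCA.
- by apply: measurable_funM => //; exact: measurable_density.
- by move=> x; rewrite mulr_ge0 ?expR_ge0// ltW.
move=> A mA; apply: (eq_trans (aE A mA)).
under [RHS]eq_integral do rewrite EFinM.
rewrite ge0_integralZl//.
- by apply/measurable_EFinP/measurable_funTS; exact: measurable_density.
- by rewrite lee_fin ltW.
Qed.

End noise_law.

Section noise_moments.
Local Open Scope ereal_scope.
Context d (Omega : measurableType d) (R : realType) (P : probability Omega R).
Variables (T : nat) (W : {RV P >-> T.-tuple (measurableTypeR R)}) (b : R).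
Local Notation tup := (T.-tuple (measurableTypeR R)).
Local Notation row := (@row_of_tuple R T).
Local Notation density b := (fun x : tup => expR (- (b * l2norm (row x)))).
Hypothesis dW : density_proportional_to W (density b).

Lemma l2normZ (c : R) (x : 'rV[R]_T) : l2norm (c *: x) = (`|c| * l2norm x)%R.
Proof.
rewrite /l2norm -sqrtr_sqr -sqrtrM ?sqr_ge0// mulr_sumr; congr Num.sqrt.
by apply: eq_bigr => j _; rewrite mxE exprMn.
Qed.

(** The density at [s x] is the density with parameter [b s], so the change of
    variables gives the normalizing constant for every parameter. *)
Lemma expectation_density_ratio (s : R) : (0 < s)%R ->
  \int[P]_o (expR (b * (1 - s) * l2norm (row (W o))))%:E = (s^-1 ^+ T)%:E.
Proof.
move=> s0; have [a a0 aE] := ge0_integral_law dW.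
have mden c := @measurable_density R T c.
have norm1 : a%:E * \int[lebesgue_tuple R T]_x (density b x)%:E = 1.
  rewrite -(@probability_setT _ _ _ P) -[RHS]mul1e -integral_cst//.
  rewrite (aE (fun=> 1))//.
  by under [in RHS]eq_integral do rewrite mul1e.
have mf : measurable_fun [set: tup] (fun x => (expR (b * (1 - s) * l2norm (row x)))%:E).
  apply/measurable_EFinP; apply: measurableT_comp => //.
  by apply: measurable_funM => //; exact: measurable_l2norm_row.
rewrite (aE (fun x => (expR (b * (1 - s) * l2norm (row x)))%:E))//.
under eq_integral => x _.
  rewrite -EFinM -expRD.
  rewrite (_ : _ + _ = - (b * l2norm (row [tuple of
    map (fun x : measurableTypeR R => s * x : measurableTypeR R) x])))%R; last first.
    by rewrite row_map_scale l2normZ gtr0_norm//; ring.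
  over.
rewrite (@ge0_integral_lebesgue_tuple_map _ s^-1 _ _ _ _ T (fun x => (density b x)%:E))//.
- by rewrite muleCA norm1 mule1.
- by rewrite invr_ge0 ltW.
- exact: mulrl_measurable.
- exact: pushforward_lebesgue_scale.
- by apply/measurable_EFinP; exact: mden.
Qed.

(** With parameter [0] the density would be constant, and halving all
    coordinates would give [1 = 2 ^+ T]. *)
Lemma noise_parameter_neq0 : (0 < T)%N -> (b != 0)%R.
Proof.
move=> T0; apply/negP => /eqP b0.
have h2 : (0 < 2^-1 :> R)%R by rewrite invr_gt0 ltr0n.
have : 1 = (2 ^+ T)%:E :> \bar R.
  rewrite -{1}(invrK 2%R) -(expectation_density_ratio h2).
  rewrite (eq_integral (fun=> 1)) => [|o _]; last by rewrite b0 !mul0r expR0.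
  rewrite integral_cst// mul1e; exact/esym/probability_setT.
move=> -[] /esym/eqP.
have /gt_eqF h1 : (1 < 2 :> R)%R by lra.
by rewrite pexprn_eq1// h1 eqn0Ngt T0.
Qed.

(** From [u ^+ 2 / 2 <= expR u], with [u] equal to [l] times the norm, the second
    moment is at most [2 / l ^+ 2] times an exponential moment. For
    [l = b / (2 T)] the latter is [(1 - 1 / (2 T)) ^- T], which is at most [2] by
    Bernoulli's inequality. *)
Lemma noise_second_moment : (0 < T)%N -> (0 < b)%R ->
  \int[P]_o (dot (row (W o)) (row (W o)))%:E <= ((4 * T%:R / b) ^+ 2)%:E.
Proof.
move=> T0 b0; have T1 : (1 <= T%:R :> R)%R by rewrite ler1n.
pose s : R := (1 - (2 * T%:R)^-1)%R.
have T2 : (0 < 2 * T%:R :> R)%R by lra.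
have Ti : ((2 * T%:R)^-1 <= 2^-1 :> R)%R by rewrite lef_pV2 ?posrE//; lra.
have Ti0 : (0 < (2 * T%:R)^-1 :> R)%R by rewrite invr_gt0.
have s0 : (0 < s)%R by rewrite /s; lra.
have sT : (2^-1 <= s ^+ T)%R.
  have bern m : (1 - m%:R * (2 * T%:R)^-1 <= s ^+ m :> R)%R.
    elim: m => [|m IH]; first by rewrite mul0r subr0 expr0.
    have m0 : (0 <= m%:R :> R)%R by [].
    rewrite exprSr; apply: le_trans (ler_wpM2r (ltW s0) IH).
    rewrite -natr1 /s; set z := (_^-1)%R in Ti0 *.
    by have := mulr_ge0 m0 (sqr_ge0 z); lra.
  apply: le_trans (bern T); rewrite invfM mulrCA divff ?lt0r_neq0//; lra.
pose l : R := (b * (1 - s))%R.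
have lE : (l = b / (2 * T%:R))%R by rewrite /l /s subKr.
have l0 : (0 < l)%R by rewrite lE divr_gt0.
have mn := measurableT_comp (@measurable_l2norm_row R T) (measurable_funP W).
have mexp : measurable_fun setT (fun o => (expR (l * l2norm (row (W o))))%:E).
  apply/measurable_EFinP; apply: measurableT_comp => //.
  by apply: measurable_funM.
apply: (@le_trans _ _ (\int[P]_o ((2 / l ^+ 2)%:E * (expR (l * l2norm (row (W o))))%:E))).
  apply: ge0_le_integral => //.
  - by move=> o _; rewrite lee_fin dotvv_ge0.
  - apply/measurable_EFinP; under eq_fun do rewrite -l2norm_sqr.
    exact: measurable_funX.
  - exact: measurable_funeM.
  - move=> o _; rewrite -EFinM lee_fin -l2norm_sqr.
    have u0 : (0 <= l * l2norm (row (W o)))%R by rewrite mulr_ge0 ?l2norm_ge0// ltW.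
    have := expR_ge1Dxn 1 u0; rewrite (_ : 2`! = 2)%N// exprMn => h.
    rewrite mulrAC ler_pdivlMr ?exprn_gt0//; lra.
rewrite ge0_integralZl//; last first.
  by rewrite lee_fin divr_ge0// sqr_ge0.
rewrite expectation_density_ratio// -EFinM lee_fin lE exprVn.
have i2 : ((s ^+ T)^-1 <= 2)%R by rewrite -[leRHS]invrK lef_pV2 ?posrE ?exprn_gt0// invr_gt0.
apply: (@le_trans _ _ (2 / (b / (2 * T%:R)) ^+ 2 * 2)%R).
  by rewrite ler_wpM2l// divr_ge0// sqr_ge0.
rewrite le_eqVlt; apply/orP; left; apply/eqP.
by field; rewrite !lt0r_neq0//; lra.
Qed.

Lemma integrable_noise_sqr : (0 < T)%N -> (0 < b)%R ->
  P.-integrable setT (fun o => (dot (row (W o)) (row (W o)))%:E).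
Proof.
move=> T0 b0; apply/integrableP; split.
  apply/measurable_EFinP; under eq_fun do rewrite -l2norm_sqr.
  apply: measurable_funX.
  exact: measurableT_comp (@measurable_l2norm_row R T) (measurable_funP W).
under eq_integral do rewrite gee0_abs ?lee_fin ?dotvv_ge0//.
exact: le_lt_trans (noise_second_moment T0 b0) (ltry _).
Qed.

Lemma measurable_noise_coord j :
  measurable_fun setT (fun o => tnth (W o) j : measurableTypeR R).
Proof. exact: measurableT_comp (measurable_tnth j) (measurable_funP W). Qed.

Lemma integrable_noise_coord j : (0 < T)%N -> (0 < b)%R ->
  P.-integrable setT (fun o => (tnth (W o) j)%:E).
Proof.
move=> T0 b0.
apply: (@le_integrable _ _ _ P setT measurableT _
  (fun o => 1 + (dot (row (W o)) (row (W o)))%:E)).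
- by apply/measurable_EFinP; exact: measurable_noise_coord.
- move=> o _; rewrite -EFinD !abse_EFin lee_fin.
  rewrite [leRHS]ger0_norm ?addr_ge0 ?dotvv_ge0//.
  have := coord_le_l2norm (row (W o)) j; rewrite mxE -l2norm_sqr => h.
  apply: le_trans h _; set z := l2norm _.
  by have := sqr_ge0 (z - 1)%R; have := sqr_ge0 z; lra.
- apply: integrableD => //; last exact: integrable_noise_sqr.
  exact: finite_measure_integrable_cst.
Qed.

(** The law is invariant under negation, which swaps the positive and the
    negative part of a coordinate. *)
Lemma noise_coord_mean j : (0 < T)%N -> (0 < b)%R ->
  \int[P]_o (tnth (W o) j)%:E = 0.
Proof.
move=> T0 b0; have [a a0 aE] := ge0_integral_law dW.
pose neg (x : measurableTypeR R) : measurableTypeR R := (- x)%R.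
have mneg : measurable_fun setT neg by exact: oppr_measurable.
pose f (x : tup) : \bar R := (Num.max (tnth x j : R) 0)%:E.
have mf : measurable_fun [set: tup] f.
  by apply/measurable_EFinP; apply: measurable_maxr => //; exact: measurable_tnth.
have f0 x : 0 <= f x by rewrite lee_fin le_max lexx orbT.
have sym : \int[P]_o f [tuple of map neg (W o)] = \int[P]_o f (W o).
  have mfn : measurable_fun [set: tup] (fun x => f [tuple of map neg x]).
    exact: measurableT_comp mf (measurable_map_tuple mneg).
  rewrite (aE (fun x => f [tuple of map neg x]))// aE//; congr (_ * _).
  pose g (x : tup) := f x * (density b x)%:E.
  have mg : measurable_fun [set: tup] g.
    by apply: emeasurable_funM => //; apply/measurable_EFinP; exact: measurable_density.
  have g0 x : 0 <= g x by rewrite mule_ge0// lee_fin expR_ge0.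
  have lneg A : measurable A -> pushforward (@lebesgue_measure R) neg A =
      1%:E * lebesgue_measure A.
    by move=> mA; rewrite mul1e; exact: lebesgue_measureN.
  have := ge0_integral_lebesgue_tuple_map ler01 mneg lneg mg g0.
  rewrite expr1n mul1e => <-; apply: eq_integral => x _.
  rewrite /g (_ : row [tuple of map neg x] = -1 *: row x)%R.
    by rewrite l2normZ normrN1 mul1r.
  by apply/rowP => i; rewrite !mxE tnth_map mulN1r.
have posE : \int[P]_o (fun o => (tnth (W o) j)%:E)^\+ o = \int[P]_o f (W o).
  by apply: eq_integral => o _; rewrite funeposE /f EFin_max.
have negE : \int[P]_o (fun o => (tnth (W o) j)%:E)^\- o = \int[P]_o f (W o).
  rewrite -sym; apply: eq_integral => o _.
  by rewrite funenegE /f EFin_max tnth_map.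
have := integrable_pos_fin_num measurableT (integrable_noise_coord j T0 b0).
by rewrite posE => fin; rewrite integralE posE negE subee.
Qed.

End noise_moments.

(** * Independence and measurability of the iterates *)

Section lipschitz_measurable.
Context d (S : measurableType d) (R : realType).

Lemma l2norm_le_sup T (u : 'rV[R]_T) (c : R) : 0 <= c ->
  (forall j, `|u 0 j| <= c) -> l2norm u <= T%:R * c.
Proof.
move=> c0 uc; apply: l2norm_le; first by rewrite mulr_ge0.
apply: (@le_trans _ _ (\sum_(j < T) c ^+ 2)).
  apply: ler_sum => j _; rewrite -expr2 -real_normK ?num_real//.
  by rewrite ler_pXn2r// nnegrE.
rewrite sumr_const card_ord -[leLHS]mulr_natl exprMn ler_wpM2r ?sqr_ge0//.
by rewrite -natrX ler_nat; case: T u uc => // m _ _; rewrite -mulnn leq_pmulr.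
Qed.

(** The space of vectors has a countable base of boxes with rational centres.
    If the value of [f] exceeds [a] at some point, then by the Lipschitz
    property the preimage of a small enough rational box around it lies in the
    set [f > a]; so this set is a countable union of preimages of boxes. *)
Lemma measurable_lipschitz T (x : S -> 'rV[R]_T) (f : S -> R) (K : R) :
  (forall j, measurable_fun setT (fun o => x o 0 j)) ->
  (forall o o', `|f o - f o'| <= K * l2norm (x o - x o')) ->
  measurable_fun setT f.
Proof.
move=> mx fK.
pose box (p : 'rV[rat]_T * nat) : set S :=
  \bigcap_j [set o | `|x o 0 j - ratr (p.1 0 j)| < p.2.+1%:R^-1].
have mbox p : measurable (box p).
  apply: fin_bigcap_measurable => // j _.
  have mj : measurable_fun setT (fun o => `|x o 0 j - ratr (p.1 0 j)|).
    by apply: measurableT_comp => //; exact: measurable_funB.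
  rewrite [X in measurable X](_ : _ = setT `&`
     (fun o => `|x o 0 j - ratr (p.1 0 j)|) @^-1` `]-oo, p.2.+1%:R^-1[).
    exact: mj.
  by apply/seteqP; split => o; rewrite /= in_itv/=; tauto.
apply: (measurability (@RGenOInfty.G R)); first exact: RGenOInfty.measurableE.
move=> _ [_ [a ->] <-]; rewrite setTI.
rewrite [X in measurable X](_ : _ = \bigcup_p
  (if pselect (box p `<=` f @^-1` `]a, +oo[) then box p else set0)).
  apply: countable_bigcupT_measurable => // p.
  by case: pselect => ?; [exact: mbox|exact: measurable0].
apply/seteqP; split => [z|z [p _]]; last first.
  by case: pselect => // sub; exact: sub.
move: z => o; rewrite /= in_itv/= andbT => ao.
pose K' := `|K| + 1; have K'0 : 0 < K' by rewrite ltr_wpDl.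
have e0 : 0 < (f o - a) / (2 * K' * T.+1%:R).
  by rewrite divr_gt0 ?subr_gt0// !mulr_gt0.
have [k] := ltr_add_invr e0; rewrite add0r => ke.
have k0 : 0 < k.+1%:R^-1 :> R by rewrite invr_gt0.
have /choice[q qP] : forall j, exists q : rat,
    ratr q \in `]x o 0 j, x o 0 j + k.+1%:R^-1[.
  by move=> j; apply: rat_in_itvoo; rewrite ltrDl.
have ox : box (\row_j q j, k) o.
  move=> j _ /=; rewrite mxE; have := qP j; rewrite in_itv/= => /andP[q1 q2].
  by rewrite ltr0_norm ?subr_lt0// opprB ltrBlDl.
exists (\row_j q j, k) => //; case: pselect => // nsub; exfalso; apply: nsub.
move=> o' o'x /=; rewrite in_itv/= andbT.
have le : l2norm (x o - x o') <= T%:R * (2 * k.+1%:R^-1).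
  apply: l2norm_le_sup => [|j]; first by rewrite mulr_ge0// ltW.
  have := ox j I; have := o'x j I; rewrite /= !mxE.
  move: (ratr (q j)) (k.+1%:R^-1) => y e; rewrite !ltr_norml => /andP[h1 h2] /andP[h3 h4].
  by rewrite ler_norml; apply/andP; split; lra.
have h : `|f o - f o'| <= K' * (T.+1%:R * (2 * k.+1%:R^-1)).
  apply: le_trans (fK o o') _.
  apply: (@le_trans _ _ (K' * l2norm (x o - x o'))).
    apply: ler_wpM2r; first exact: l2norm_ge0.
    by apply: le_trans (ler_norm K) _; rewrite lerDl.
  apply: ler_wpM2l; first exact: ltW.
  apply: le_trans le _; apply: ler_wpM2r; first by rewrite mulr_ge0// ltW.
  by rewrite ler_nat.
have : K' * (T.+1%:R * (2 * k.+1%:R^-1)) < f o - a.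
  have KT : 0 < 2 * K' * T.+1%:R by rewrite !mulr_gt0.
  move: ke; rewrite ltr_pdivlMr//.
  by apply: le_lt_trans; rewrite le_eqVlt; apply/orP; left; apply/eqP; ring.
by move: h; move: (K' * _) => z; rewrite ler_norml => /andP[_]; lra.
Qed.

End lipschitz_measurable.

Section past.
Context d (Omega : measurableType d) (R : realType) (P : probability Omega R).
Context d' (E : measurableType d').
Variables (K : nat) (w : nat -> {RV P >-> E}).
Hypothesis indep : mutually_independent [set k | (2 <= k <= K)%N] w.

(** Conditions on all the draws before the one of index [k] at once, rather than
    on single draws, so that the family is closed under intersection. *)
Definition past_cylinders k : set (set Omega) :=
  [set A | exists2 B : nat -> set E, (forall i, measurable (B i)) &
     A = \bigcap_(i in [set i | (2 <= i < k)%N]) w i @^-1` B i].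

Local Notation past k := (g_sigma_algebraType (past_cylinders k)).

Lemma past_cylindersI k : setI_closed (past_cylinders k).
Proof.
move=> _ _ [B mB ->] [C mC ->]; exists (fun i => B i `&` C i).
  by move=> i; exact: measurableI.
by rewrite -bigcapI; apply: eq_bigcapr => i _; rewrite preimage_setI.
Qed.

Lemma past_mono k : past_cylinders k `<=` past_cylinders k.+1.
Proof.
move=> _ [B mB ->]; exists (fun i => if (i < k)%N then B i else setT).
  by move=> i; case: ifP.
apply/seteqP; split => o Bo i /= ik.
  by case: ifPn => // ik'; apply: Bo; apply/andP; split => //; case/andP: ik.
have := Bo i; case/andP: ik => i2 ik; rewrite /= ik; apply.
by apply/andP; split => //; exact: ltnW.
Qed.

Lemma measurable_past_sub k (A : set (past k)) : measurable A ->
  measurable (A : set Omega).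
Proof.
apply: smallest_sub; first exact: sigma_algebra_measurable.
move=> _ [B mB ->]; apply: fin_bigcap_measurable.
  by apply: (sub_finite_set _ (finite_II k)) => i /= /andP[].
move=> i _; rewrite -[X in measurable X]setTI.
exact: (measurable_funP (w i)).
Qed.

Lemma measurable_past_noise k i : (2 <= i < k)%N ->
  measurable_fun [set: past k] (w i : past k -> E).
Proof.
move=> ik _ B mB; rewrite setTI; apply: sub_sigma_algebra.
exists (fun j => if j == i then B else setT); first by move=> j; case: ifP.
apply/seteqP; split => o /=; last by move=> /(_ i ik) /=; rewrite eqxx.
by move=> Bo j /= _; case: ifPn => // /eqP ->.
Qed.

Lemma measurable_past_succ k (f : Omega -> R) :
  measurable_fun [set: past k] (f : past k -> R) ->
  measurable_fun [set: past k.+1] (f : past k.+1 -> R).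
Proof.
move=> mf _ B mB; rewrite setTI.
have := mf measurableT B mB; rewrite setTI.
by apply: sub_sigma_algebra2; exact: past_mono.
Qed.

Lemma measurable_past_full k (f : Omega -> R) :
  measurable_fun [set: past k] (f : past k -> R) -> measurable_fun setT f.
Proof.
move=> mf _ B mB; apply: (@measurable_past_sub k).
exact: mf measurableT B mB.
Qed.

(** Mutual independence gives the product rule on cylinders; Dynkin's theorem
    extends it to the sigma-algebra that they generate. *)
Lemma past_independent k (A : set (past k)) (B : set E) : (2 <= k <= K)%N ->
  measurable A -> measurable B ->
  P ((A : set Omega) `&` w k @^-1` B) = (P A * P (w k @^-1` B))%E.
Proof.
move=> k2K mA mB; have /andP[k2 kK] := k2K.
have mBk : measurable (w k @^-1` B).
  by rewrite -[X in measurable X]setTI; exact: (measurable_funP (w k)).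
pose Q (S : set (past k)) := P ((S : set Omega) `&` w k @^-1` B) = (P S * P (w k @^-1` B))%E.
apply: (@dynkin_induction _ (past k) (past_cylinders k) Q _ _ _ _ _ _ A mA) => //.
- exact: past_cylindersI.
- by rewrite /Q setTI probability_setT mul1e.
- move=> _ [C mC ->].
  pose J := [fset i in iota 2 (k - 2)]%fset.
  pose D i := if i == k then B else C i.
  have JE i : (i \in J) = (2 <= i < k)%N.
    by rewrite !inE mem_iota subnKC.
  have kJ : k \notin J by rewrite JE ltnn andbF.
  have mD i : measurable (D i) by rewrite /D; case: ifP.
  have h1 := indep (J := J) (B := D).
  have h2 := indep (J := (k |` J)%fset) (B := D).
  rewrite /Q.
  have -> : \bigcap_(i in [set i | (2 <= i < k)%N]) w i @^-1` C i =
      \bigcap_(i in [set` J]) w i @^-1` D i.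
    apply/seteqP; split => o Co i /=.
      by rewrite JE => /[dup] /andP[_ ik] /Co; rewrite /D ltn_eqF.
    move=> /[dup] ik; rewrite -JE => /Co; rewrite /D ltn_eqF//.
    by case/andP: ik.
  have -> : \bigcap_(i in [set` J]) w i @^-1` D i `&` w k @^-1` B =
      \bigcap_(i in [set` (k |` J)%fset]) w i @^-1` D i.
    apply/seteqP; split => o /=.
      move=> [Do Bo] i /=; rewrite in_fset1U => /orP[/eqP ->|]; first by rewrite /D eqxx.
      exact: Do.
    move=> Do; split; last by have := Do k; rewrite /= in_fset1U eqxx /D eqxx; exact.
    by move=> i /= iJ; apply: Do; rewrite /= in_fset1U iJ orbT.
  rewrite h1//; last first.
    by move=> i /=; rewrite JE => /andP[-> /ltnW ik]; rewrite (leq_trans ik).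
  rewrite h2//; last first.
    move=> i /=; rewrite in_fset1U JE => /orP[/eqP ->//|].
    by move=> /andP[-> /ltnW ik]; rewrite (leq_trans ik).
  by rewrite big_fsetU1//= muleC /D eqxx.
- move=> S mS; rewrite /Q => QS.
  have mS' := measurable_past_sub mS.
  rewrite probability_setC// setIC -setDE measureD//; last first.
    exact: le_lt_trans (probability_le1 P mBk) (ltry 1).
  rewrite [RHS]muleBl ?fin_num_measure// mul1e; congr (_ - _)%E.
  by rewrite setIC; exact: QS.
- move=> F mF tF QF; rewrite /Q setI_bigcupl.
  have mF' n := measurable_past_sub (mF n).
  rewrite measure_bigcup//; last 2 first.
  - by move=> n _; exact: measurableI.
  - exact: trivIset_setIr.
  rewrite measure_bigcup//.
  have pB : P (w k @^-1` B) = (fine (P (w k @^-1` B)))%:E.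
    by rewrite fineK// fin_num_measure.
  rewrite [RHS]muleC pB -nneseriesZl//.
  by apply: eq_eseriesr => n _; rewrite -pB [RHS]muleC; exact: QF.
Qed.

End past.

Section unbiased.
Local Open Scope ereal_scope.
Context d (Omega : measurableType d) (R : realType) (P : probability Omega R).

(** The joint law of independent variables is a product measure, so Fubini's
    theorem lets the centred factor be integrated first. *)
Lemma integral_indep_centered (X Y : {RV P >-> R}) (M : R) :
  (forall A B, measurable A -> measurable B ->
     P (X @^-1` A `&` Y @^-1` B) = P (X @^-1` A) * P (Y @^-1` B)) ->
  (forall o, `|X o| <= M)%R ->
  P.-integrable setT (EFin \o Y) -> \int[P]_o (Y o)%:E = 0 ->
  P.-integrable setT (fun o => (X o * Y o)%:E) /\ \int[P]_o (X o * Y o)%:E = 0.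
Proof.
move=> XY XM iY Y0.
have iXY : P.-integrable setT (fun o => (X o * Y o)%:E).
  rewrite (_ : (fun o => _) = (EFin \o X) \* (EFin \o Y)); last first.
    by apply/funext => o; rewrite /= EFinM.
  apply: integrableMr => //.
  exists M; split; first exact: num_real.
  by move=> x Mx o _; exact: le_trans (XM o) (ltW Mx).
split=> //.
pose Z o := (X o, Y o).
have mZ : measurable_fun setT Z by exact: measurable_fun_pair.
pose f (z : R * R) : \bar R := (z.1 * z.2)%:E.
have mf : measurable_fun setT f.
  by apply/measurable_EFinP; exact: measurable_funM.
have iZ : P.-integrable (Z @^-1` setT) (f \o Z) by rewrite preimage_setT.
have := integral_pushforward mZ mf iZ measurableT.
rewrite preimage_setT => <-.
have ZE A : measurable A ->
    (distribution P X \x distribution P Y) A = pushforward P Z A.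
  move=> mA; apply: (@product_measure_unique _ _ _ _ _ _ _
    (measure_function_pushforward__canonical__measure_function_Measure P mZ)) mA.
  by move=> B C mB mC; exact: XY.
have ipush := integrable_pushforward mZ mf iZ measurableT.
have iprod : (distribution P X \x distribution P Y).-integrable setT f.
  apply/integrableP; split => //; case/integrableP: ipush => _; apply: le_lt_trans.
  by rewrite (@eq_measure_integral _ _ _ _ (pushforward P Z))// => A mA _; exact: ZE.
rewrite -(@eq_measure_integral _ _ _ _ _ (distribution P X \x distribution P Y)); last first.
  by move=> A mA _; exact: ZE.
rewrite -integral12_prod_meas1//.
rewrite (eq_integral (fun=> 0)) ?integral0// => x _.
rewrite /fubini_F /f /=; under eq_integral do rewrite EFinM.
have iid : (distribution P Y).-integrable setT (EFin : R -> \bar R).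
  have := @integrable_pushforward _ _ _ _ _ _ (measurable_funP Y) P setT EFin.
  by rewrite preimage_setT; apply.
rewrite integralZl// (_ : \int[_]_y _ = 0) ?mule0//.
rewrite -[RHS]Y0.
have := @integral_pushforward _ _ _ _ _ _ (measurable_funP Y) P setT EFin.
by rewrite preimage_setT; apply.
Qed.

End unbiased.

Section centered_dot.
Local Open Scope ereal_scope.
Context d (Omega : measurableType d) (R : realType) (P : probability Omega R).
Variables (T K : nat) (w : nat -> {RV P >-> T.-tuple (measurableTypeR R)}).
Local Notation past k := (g_sigma_algebraType (past_cylinders w k)).

(** Coordinate by coordinate, a bounded vector that is decided before the draw is
    independent of it. *)
Lemma integral_past_noise (k : nat) (b M : R) (X : Omega -> 'rV[R]_T) :
  mutually_independent [set k | (2 <= k <= K)%N] w -> (2 <= k <= K)%N ->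
  (0 < T)%N -> (0 < b)%R ->
  density_proportional_to (w k) (fun x => expR (- (b * l2norm (row_of_tuple x)))) ->
  (forall j, measurable_fun [set: past k] (fun o : past k => X o 0%R j)) ->
  (forall o j, `|X o 0%R j| <= M)%R ->
  P.-integrable setT (fun o => (dot (row_of_tuple (w k o)) (X o))%:E) /\
  \int[P]_o (dot (row_of_tuple (w k o)) (X o))%:E = 0.
Proof.
move=> indep k2K T0 b0 dw mX XM.
have coord j : P.-integrable setT (fun o => (X o 0%R j * tnth (w k o) j)%:E) /\
    \int[P]_o (X o 0%R j * tnth (w k o) j)%:E = 0.
  have mXj := measurable_past_full (mX j).
  have mYj : measurable_fun setT (fun o => tnth (w k o) j : R) :=
    measurable_noise_coord (w k) j.
  pose Xj : {RV P >-> R} := HB.pack (fun o => X o 0%R j)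
    (isMeasurableFun.Build _ _ _ _ _ mXj).
  pose Yj : {RV P >-> R} := HB.pack (fun o => tnth (w k o) j : R)
    (isMeasurableFun.Build _ _ _ _ _ mYj).
  apply: (@integral_indep_centered _ _ _ P Xj Yj M).
  - move=> A B mA mB.
    have mB' : measurable ((fun t : T.-tuple (measurableTypeR R) => tnth t j) @^-1` B).
      by rewrite -[X in measurable X]setTI; exact: measurable_tnth.
    have mA' : measurable ((fun o : past k => X o 0%R j) @^-1` A).
      by rewrite -[X in measurable X]setTI; exact: mX.
    exact: (past_independent indep k2K mA' mB').
  - by move=> o; exact: XM.
  - exact: integrable_noise_coord dw _ T0 b0.
  - exact: noise_coord_mean dw _ T0 b0.
have dotE' o : (dot (row_of_tuple (w k o)) (X o))%:E =
    \sum_(j < T) (X o 0%R j * tnth (w k o) j)%:E.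
  by rewrite sumEFin; congr EFin; apply: eq_bigr => j _; rewrite mxE mulrC.
have isum : P.-integrable setT (fun o => \sum_(j < T) (X o 0%R j * tnth (w k o) j)%:E).
  by apply: integrable_sum => // j _; exact: (coord j).1.
rewrite (_ : (fun o => _) = fun o => \sum_(j < T) (X o 0%R j * tnth (w k o) j)%:E); last first.
  exact/funext.
split=> //.
rewrite integral_sum//; last by move=> j; exact: (coord j).1.
by rewrite big1// => j _; exact: (coord j).2.
Qed.

End centered_dot.

Section expected_average.
Local Open Scope ereal_scope.
Context d (Omega : measurableType d) (R : realType) (P : probability Omega R).

(** The recursion of [weighted_avg] commutes with expectation. *)
Lemma expected_weighted_avg (eta Q : R) (K : nat) (e : nat -> Omega -> R) :
  (1 <= eta)%R -> (0 <= Q)%R ->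
  (forall k, (2 <= k <= K)%N -> P.-integrable setT (EFin \o e k) /\
     \int[P]_o (e k o)%:E <= (Q / Num.sqrt k%:R)%:E) ->
  forall m, (m.+1 <= K)%N ->
  P.-integrable setT (fun o => (weighted_avg eta (fun k => e k o) m)%:E) /\
  \int[P]_o (weighted_avg eta (fun k => e k o) m)%:E <= (2 * Q / Num.sqrt m.+1%:R)%:E.
Proof.
move=> eta1 Q0 he; elim=> [_|m IH mK].
  split; first exact: integrable0.
  by rewrite integral0 lee_fin divr_ge0 ?mulr_ge0// sqrtr_ge0.
have [iA EA] := IH (ltnW mK).
have [ie Ee] := he m.+2 mK.
set t := theta eta m.+1.
have t0 : (0 <= t)%R by exact: theta_ge0.
have t1 : (0 <= 1 - t)%R by rewrite subr_ge0; exact: theta_le1.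
have avgE : (fun o => (weighted_avg eta (fun k => e k o) m.+1)%:E) =
    (fun o => (1 - t)%:E * (weighted_avg eta (fun k => e k o) m)%:E) \+
    (fun o => t%:E * (e m.+2 o)%:E).
  by apply/funext => o; rewrite /= -!EFinM -EFinD.
have i1 : P.-integrable setT (fun o => (1 - t)%:E * (weighted_avg eta (fun k => e k o) m)%:E).
  exact: integrableZl.
have i2 : P.-integrable setT (fun o => t%:E * (e m.+2 o)%:E) by exact: integrableZl.
rewrite avgE; split; first exact: integrableD.
rewrite integralD// !integralZl//.
apply: (@le_trans _ _ ((1 - t)%:E * (2 * Q / Num.sqrt m.+1%:R)%:E +
    t%:E * (Q / Num.sqrt m.+2%:R)%:E)).
  by apply: leeD; apply: lee_wpmul2l.
by rewrite -!EFinM -EFinD lee_fin weighted_avg_step.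
Qed.

(** The lower integral of a nonnegative function is monotone without any
    measurability. *)
Lemma ge0_le_integral_majorant (f g : Omega -> \bar R) :
  (forall o, 0 <= f o) -> (forall o, f o <= g o) ->
  \int[P]_o f o <= \int[P]_o g o.
Proof.
move=> f0 fg; have g0 o : 0 <= g o by exact: le_trans (f0 o) (fg o).
rewrite !ge0_integralTE//; apply: le_ereal_sup => _ [h /= hf <-].
by exists h => //= o; exact: le_trans (hf o) (fg o).
Qed.

End expected_average.

(** * Executions of the algorithm *)

Section run.
Context d (Omega : measurableType d) (R : realType) (P : probability Omega R).
Variables (n T K : nat) (U : 'rV[R]_T -> R) (L : R) (C : 'I_n -> set 'rV[R]_T).
Variables (c eta : R) (w : nat -> {RV P >-> T.-tuple (measurableTypeR R)}).
Variables (r0 : 'I_n -> 'rV[R]_T) (r rhat : nat -> Omega -> 'I_n -> 'rV[R]_T).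
Hypothesis cU : convex_function setT U.
Hypothesis dU : forall x, differentiable U x.
Hypothesis LU : lipschitz_gradient U L.
Hypothesis cC : forall i, convex_set (C i).
Hypothesis C0 : forall i, C i !=set0.
Hypothesis Cb : has_ubound (norms C).
Hypothesis c0 : 0 < c.
Hypothesis eta1 : 1 <= eta.
Hypothesis w1 : forall o, row_of_tuple (w 1%N o) = 0.
Hypothesis run : forall o, dp_run K U C (fun k => c / Num.sqrt k%:R) eta r0
  (fun k => row_of_tuple (w k o)) (fun k => r k o) (fun k => rhat k o).

Let rho := sup (norms C).
Let G := sup (gradient_norms U C).
Let W k o := row_of_tuple (w k o).
Local Notation past k := (g_sigma_algebraType (past_cylinders w k)).

Lemma run_feasible k o : (1 <= k <= K)%N -> feasible C (r k.+1 o).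
Proof. by move=> kK i; have [_ _ /(_ k kK i) [? _] _] := run o. Qed.

(** The first weight is [1], so the initial point, which need not be feasible,
    does not enter the averages. *)
Lemma run_avg_feasible k o : (1 <= k <= K)%N -> feasible C (rhat k.+1 o).
Proof.
have [_ _ _ avg] := run o.
elim: k => // k IH kK i; rewrite avg//.
have [->|k0] := eqVneq k 0%N.
  by rewrite theta1// subrr scale0r add0r scale1r; apply: run_feasible; lia.
have t01 : 0 <= theta eta k.+1 <= 1 by rewrite theta_ge0 ?theta_le1.
have kK' : (1 <= k <= K)%N by lia.
exact: (feasible_comb cC (IH kK') (run_feasible o kK) t01 i).
Qed.

Lemma run_avg_value k o : (1 <= k <= K)%N ->
  U (\sum_i rhat k.+1 o i) <= (1 - theta eta k) * U (\sum_i rhat k o i)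
                              + theta eta k * U (\sum_i r k.+1 o i).
Proof.
move=> kK; have [_ _ _ avg] := run o.
under eq_bigr do rewrite avg//.
rewrite big_split -!scaler_sumr.
case/andP: kK => k0 _.
have t01 : 0 <= 1 - theta eta k <= 1.
  by rewrite subr_ge0 theta_le1//= gerBl theta_ge0.
by have := convex_comb cU (\sum_i rhat k o i) (\sum_i r k.+1 o i) t01; rewrite subKr.
Qed.

(** The first projection is applied to the same point in every outcome, and a
    later iterate is a nonexpansive function of the previous one, its gradient
    and the last draw. *)
Lemma run_past_measurable k i j : (2 <= k <= K.+1)%N ->
  measurable_fun [set: past k] (fun o : past k => r k o i 0 j).
Proof.
elim: k i j => // k IH i j; rewrite ltnS => /andP[k1 kK].
have kK' : (1 <= k <= K)%N by rewrite k1.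
pose g o := gradient U (\sum_i r k o i).
pose x o := r k o i - (c / Num.sqrt k%:R) *: (g o + W k o).
have px o : is_proj (C i) (x o) (r k.+1 o i).
  by have [_ _ /(_ k kK' i)] := run o.
have lip o o' : `|r k.+1 o i 0 j - r k.+1 o' i 0 j| <= 1 * l2norm (x o - x o').
  rewrite mul1r; have := coord_le_l2norm (r k.+1 o i - r k.+1 o' i) j.
  rewrite !mxE => /le_trans; apply; exact: (proj_nonexpansive (@cC i) (px o) (px o')).
have [k_eq1|k_neq1] := eqVneq k 1%N.
  have xE o o' : x o = x o'.
    have rE o1 i1 : r 1%N o1 i1 = r0 i1 by have [] := run o1.
    rewrite /x /g /W k_eq1 !w1 !rE.
    by under eq_bigr do rewrite rE; under [in RHS]eq_bigr do rewrite rE.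
  have pE o : r k.+1 o i = r k.+1 point i.
    by apply: (proj_unique (@cC i) (px o)); rewrite (xE o point); exact: px.
  by under eq_fun do rewrite pE; exact: measurable_cst.
have k2 : (2 <= k)%N by lia.
have mr i' j' : measurable_fun [set: past k.+1] (fun o : past k.+1 => r k o i' 0 j').
  by apply: measurable_past_succ; apply: IH; rewrite k2 ltnW.
have mg j' : measurable_fun [set: past k.+1] (fun o : past k.+1 => g o 0 j').
  apply: (@measurable_lipschitz _ (past k.+1) R T (fun o => \sum_i r k o i) _ L).
    move=> j0; under eq_fun do rewrite summxE.
    by apply: measurable_sum => i'; exact: mr.
  move=> o o'; have := coord_le_l2norm (g o - g o') j'.
  by rewrite mxE [X in _ + X]mxE => /le_trans; apply; exact: LU.
apply: (@measurable_lipschitz _ (past k.+1) R T x _ 1) => // j'.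
rewrite (_ : (fun o => _) = fun o => r k o i 0 j' -
    (c / Num.sqrt k%:R) * (g o 0 j' + tnth (w k o) j')); last first.
  by apply/funext => o; rewrite !mxE.
apply: measurable_funB; first exact: mr.
apply: measurable_funM => //; apply: measurable_funD; first exact: mg.
apply: (measurableT_comp (measurable_tnth j')).
by apply: measurable_past_noise; rewrite k2 ltnSn.
Qed.

(** What the noise adds to the gap of the iterate of index [k], besides the
    change of the distance to [x]; see [descent_step]. *)
Definition run_error (x : 'I_n -> 'rV[R]_T) k o : R :=
  c / Num.sqrt k%:R * n%:R * (G ^+ 2 + dot (W k o) (W k o))
  + dot (W k o) (\sum_i x i - \sum_i r k o i).

(** The draw of index [k] is centred and independent of the iterate of index
    [k], so the linear part of the error vanishes in expectation. *)
Lemma run_error_expectation (b : R) x k : (0 < T)%N -> 0 < b ->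
  (2 <= k <= K)%N -> feasible C x ->
  mutually_independent [set k | (2 <= k <= K)%N] w ->
  density_proportional_to (w k) (fun t => expR (- (b * l2norm (row_of_tuple t)))) ->
  P.-integrable setT (fun o => (run_error x k o)%:E) /\
  (\int[P]_o (run_error x k o)%:E <=
   ((c * n%:R * (G ^+ 2 + (4 * T%:R / b) ^+ 2)) / Num.sqrt k%:R)%:E)%E.
Proof.
move=> T0 b0 k2K Cx indep dw.
have [/andP[k2 kK]] := k2K.
pose X o := \sum_i x i - \sum_i r k o i.
pose M := Num.sqrt n%:R * (2 * rho).
have Cr o : feasible C (r k o).
  by case: k k2 kK {k2K dw X} => // k k2 kK; apply: run_feasible; lia.
have XM o j : `|X o 0 j| <= M.
  by apply: le_trans (coord_le_l2norm _ _) _; exact: norm_sumB_le.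
have mX j : measurable_fun [set: past k] (fun o : past k => X o 0 j).
  rewrite (_ : (fun o => _) = fun o => (\sum_i x i) 0 j - \sum_i r k o i 0 j); last first.
    by apply/funext => o; rewrite !mxE !summxE.
  apply: measurable_funB => //; apply: measurable_sum => i.
  by apply: run_past_measurable; rewrite k2 ltnW.
have [iX EX] := integral_past_noise indep k2K T0 b0 dw mX XM.
have iWW := integrable_noise_sqr dw T0 b0.
have EWW := noise_second_moment dw T0 b0.
pose a := c / Num.sqrt k%:R * n%:R.
have a0 : 0 <= a by rewrite !mulr_ge0// ?invr_ge0 ?sqrtr_ge0// ltW.
have eE : (fun o => (run_error x k o)%:E) =
  (fun o => a%:E * ((G ^+ 2)%:E + (dot (W k o) (W k o))%:E) + (dot (W k o) (X o))%:E)%E.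
  by [].
have iG : P.-integrable setT (fun=> (G ^+ 2)%:E).
  exact: finite_measure_integrable_cst.
have iGW := integrableD measurableT iG iWW.
have iaGW := integrableZl measurableT a iGW.
rewrite eE; split; first exact: integrableD.
have EG : (\int[P]_o (G ^+ 2)%:E = (G ^+ 2)%:E)%E.
  rewrite integral_cst// -[RHS]mule1; congr (_ * _)%E; exact: probability_setT.
rewrite integralD// EX adde0 integralZl// integralD// EG.
apply: (@le_trans _ _ (a%:E * ((G ^+ 2)%:E + ((4 * T%:R / b) ^+ 2)%:E))%E).
  by apply: lee_wpmul2l; [rewrite lee_fin|exact: leeD2l].
by rewrite -EFinD -EFinM lee_fin /a le_eqVlt; apply/orP; left; apply/eqP; ring.
Qed.

(** The last averaged iterate contains the plain iterate of index [K.+1], from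
    which no step is made. Its gap is bounded by the diameter, which is harmless
    because its weight [theta eta K] is of order [eta / K]. *)
Lemma run_gap_le x m o : K = m.+2 -> feasible C x ->
  U (\sum_i rhat K.+1 o i) - U (\sum_i x i) <=
  (eta * (2 * rho) ^+ 2 / c + 2 * eta * (G * (Num.sqrt n%:R * (2 * rho)))) / Num.sqrt K%:R
  + (1 - theta eta K) * weighted_avg eta (fun k => run_error x k o) m.+1.
Proof.
move=> Km Cx.
pose h k := U (\sum_i rhat k o i) - U (\sum_i x i).
pose f k := U (\sum_i r k o i) - U (\sum_i x i).
have hf k : (1 <= k <= K)%N -> h k.+1 <= (1 - theta eta k) * h k + theta eta k * f k.+1.
  by move=> kK; have := run_avg_value o kK; rewrite /h /f; lra.
have Cr k : (2 <= k <= K.+1)%N -> feasible C (r k o).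
  by case: k => // k kK; apply: run_feasible; lia.
have dD k : (2 <= k <= K.+1)%N -> dist2 (r k o) x <= (2 * rho) ^+ 2.
  by move=> kK; apply: dist2_feasible_le => //; exact: Cr.
have fd k : (2 <= k <= K)%N -> f k <= Num.sqrt k%:R / (2 * c) *
    (dist2 (r k o) x - dist2 (r k.+1 o) x) + run_error x k o.
  move=> kK; have [_ _ /(_ k) proj _] := run o.
  have sk : 0 < Num.sqrt k%:R :> R by rewrite sqrtr_gt0 ltr0n; lia.
  have a0 : 0 < c / Num.sqrt k%:R by rewrite divr_gt0.
  have Crk : feasible C (r k o) by apply: Cr; lia.
  have kK1 : (1 <= k <= K)%N by lia.
  have := descent_step cU dU LU C0 Cb cC Crk Cx a0 (proj kK1).
  rewrite (_ : (2 * (c / Num.sqrt k%:R))^-1 = Num.sqrt k%:R / (2 * c))//.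
  by rewrite mulrA invfM invrK mulrC.
have main := averaged_descent eta1 c0 dD hf fd (m := m).
rewrite -Km leqnn in main; have {}main := main isT.
have K1 : (1 <= K <= K)%N by lia.
have t0 := theta_ge0 K eta1; have t1 := theta_le1 eta1 (ltn0Sn m.+1).
rewrite -Km in t1.
have fK : f K.+1 <= G * (Num.sqrt n%:R * (2 * rho)).
  by apply: gap_le => //; apply: Cr; lia.
have g0 : 0 <= G * (Num.sqrt n%:R * (2 * rho)).
  by rewrite !mulr_ge0 ?sqrtr_ge0 ?radius_ge0//; exact: gradient_bound_ge0.
have D0 : 0 <= (2 * rho) ^+ 2 := sqr_ge0 _.
have d0 := dist2_ge0 (r K.+1 o) x.
set s := Num.sqrt K%:R in main *.
have s0 : 0 < s by rewrite sqrtr_gt0 ltr0n Km.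
have ss : s ^+ 2 = K%:R by rewrite sqr_sqrtr.
have s1 : 1 <= s by rewrite -sqrtr1 ler_sqrt// ler1n Km.
have theta_s k : (0 < k)%N -> (K <= k.+1)%N -> theta eta k <= 2 * eta / s ^+ 2.
  move=> k0 kK; apply: le_trans (theta_le eta1 k0) _; rewrite ss.
  apply: ler_wpM2l; first by rewrite mulr_ge0//; apply: le_trans eta1.
  by rewrite lef_pV2 ?posrE ?ltr0n ?Km// ler_nat -Km.
have K0 : (0 < K)%N by rewrite Km.
have u0 := theta_ge0 m.+1 eta1.
have us := theta_s m.+1 isT (eq_leq Km).
have ts := theta_s K K0 (leqnSn K).
have hK := hf K K1.
move: {theta_s hf fd} main hK fK; rewrite -/(h K.+1).
move: (h K) (h K.+1) (f K.+1) (dist2 _ _) d0 => h2 h3 f3 dd d0.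
move: (weighted_avg _ _ _) => A.
move: (G * _) g0 ((2 * rho) ^+ 2) D0 => g g0 D D0.
move: (theta eta m.+1) (theta eta K) u0 us t0 t1 ts => u t u0 us t0 t1 ts main hK fK.
have us' : u * (s / (2 * c)) <= eta / c / s.
  apply: (@le_trans _ _ (2 * eta / s ^+ 2 * (s / (2 * c)))).
    by apply: ler_wpM2r us; rewrite divr_ge0 ?mulr_ge0// ltW.
  by rewrite le_eqVlt; apply/orP; left; apply/eqP; field; rewrite !lt0r_neq0.
have ts' : t <= 2 * eta / s.
  apply: le_trans ts _; apply: ler_wpM2l; first by rewrite mulr_ge0// (le_trans ler01 eta1).
  by rewrite lef_pV2 ?posrE ?exprn_gt0// expr2 ler_peMl// ltW.
have v0 : 0 <= u * (s / (2 * c)) by rewrite mulr_ge0// divr_ge0 ?mulr_ge0// ltW.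
move: (u * _) us' v0 main => v us' v0 main.
rewrite (_ : _ / s = eta / c / s * D + 2 * eta / s * g); last by ring.
have := ler_wpM2r g0 ts'.
have := ler_wpM2r D0 us'.
have := ler_wpM2l t0 fK.
have t1' : 0 <= 1 - t by lra.
have := ler_wpM2l t1' main.
have := mulr_ge0 (mulr_ge0 t1' v0) d0.
have := mulr_ge0 (mulr_ge0 t0 v0) D0.
move: (eta / c / s) (2 * eta / s) => p q.
lra.
Qed.

(** The expectation of the bound along a path. The gap is compared with every
    feasible point rather than with a minimizer, which need not exist as the
    feasible set need not be closed. *)
Lemma run_expected_gap_le (b : R) m : K = m.+2 -> (0 < T)%N -> 0 < b ->
  mutually_independent [set k | (2 <= k <= K)%N] w ->
  (forall k, (2 <= k <= K)%N -> density_proportional_to (w k)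
     (fun t => expR (- (b * l2norm (row_of_tuple t))))) ->
  ('E_P[fun o => (U (\sum_(i < n) rhat K.+1 o i) - optimal_value U C)%R] <=
   ((eta * (2 * rho) ^+ 2 / c + 2 * eta * (G * (Num.sqrt n%:R * (2 * rho)))
    + 2 * (c * n%:R * (G ^+ 2 + (4 * T%:R / b) ^+ 2))) / Num.sqrt K%:R)%:E)%E.
Proof.
move=> Km T0 b0 indep dw.
apply/lee_addgt0Pr => e e0.
have [x Cx xe] := optimal_value_approx cU dU LU C0 Cb e0.
pose B := (eta * (2 * rho) ^+ 2 / c + 2 * eta * (G * (Num.sqrt n%:R * (2 * rho))))
  / Num.sqrt K%:R.
pose Q := c * n%:R * (G ^+ 2 + (4 * T%:R / b) ^+ 2).
have Q0 : 0 <= Q by rewrite !mulr_ge0 ?addr_ge0 ?sqr_ge0// ltW.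
have K1 : (1 <= K <= K)%N by rewrite Km leqnn.
have he k (kK : (2 <= k <= K)%N) := run_error_expectation T0 b0 kK Cx indep (dw k kK).
have mK : (m.+2 <= K)%N by rewrite Km.
have [iA EA] := expected_weighted_avg eta1 Q0 he mK.
rewrite -Km in EA.
have t1 : 0 <= 1 - theta eta K by rewrite subr_ge0 theta_le1// Km.
rewrite unlock.
have cst : P.-integrable setT (fun=> (B + e)%:E) by exact: finite_measure_integrable_cst.
have iA' := integrableZl measurableT (1 - theta eta K) iA.
apply: (@le_trans _ _ (\int[P]_o ((B + e)%:E + (1 - theta eta K)%:E *
    (weighted_avg eta (fun k => run_error x k o) m.+1)%:E))%E).
  apply: ge0_le_integral_majorant => o.
    rewrite lee_fin subr_ge0.
    exact: (optimal_value_le cU dU LU C0 Cb (run_avg_feasible o K1)).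
  rewrite -EFinM -EFinD lee_fin.
  by have := run_gap_le o Km Cx; rewrite -/B; lra.
rewrite integralD// integralZl//.
have -> : (\int[P]_o (B + e)%:E = (B + e)%:E)%E.
  rewrite integral_cst// -[RHS]mule1; congr (_ * _)%E; exact: probability_setT.
apply: (@le_trans _ _ ((B + e)%:E + (2 * Q / Num.sqrt K%:R)%:E)%E).
  apply: leeD2l; apply: (@le_trans _ _ ((1 - theta eta K)%:E * (2 * Q / Num.sqrt K%:R)%:E)%E).
    by apply: lee_wpmul2l.
  rewrite -EFinM lee_fin ler_piMl//; last by rewrite gerBl theta_ge0.
  by rewrite divr_ge0 ?sqrtr_ge0// mulr_ge0.
rewrite -!EFinD lee_fin le_eqVlt; apply/orP; left; apply/eqP.
by rewrite /B /Q; ring.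
Qed.

Lemma run_crude_gap_le : (0 < K)%N ->
  ('E_P[fun o => (U (\sum_(i < n) rhat K.+1 o i) - optimal_value U C)%R] <=
   (G * (Num.sqrt n%:R * (2 * rho)))%:E)%E.
Proof.
move=> K0; apply/lee_addgt0Pr => e e0.
have [x Cx xe] := optimal_value_approx cU dU LU C0 Cb e0.
have K1 : (1 <= K <= K)%N by rewrite K0 leqnn.
rewrite unlock -EFinD.
set B := G * _; apply: (@le_trans _ _ (\int[P]_o (B + e)%:E)%E).
  apply: ge0_le_integral_majorant => o; rewrite lee_fin.
    by rewrite subr_ge0; exact: (optimal_value_le cU dU LU C0 Cb (run_avg_feasible o K1)).
  have := gap_le cU dU LU C0 Cb (run_avg_feasible o K1) Cx.
  by rewrite -/rho -/G -/B; lra.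
rewrite integral_cst// -[leRHS]mule1 le_eqVlt; apply/orP; left; apply/eqP.
congr (_ * _)%E; exact: probability_setT.
Qed.

End run.

(** * Choice of the step size and conclusion *)

Lemma powR_three_halves (R : realType) (x : R) : 0 <= x ->
  x `^ (3 / 2) = x * Num.sqrt x.
Proof.
move=> x0; rewrite (_ : 3 / 2 = 1 + 2^-1); last by lra.
rewrite powRD; last by apply/implyP => /eqP h; exfalso; lra.
by rewrite powRr1// powR12_sqrt.
Qed.

(** For [c = D / (sn (G + sg))] the terms in [D ^+ 2 / c] and in [c] balance. *)
Lemma balanced_step_bound (R : realType) (eta D sn G sg c : R) :
  1 <= eta -> 0 < D -> 0 < sn -> 0 <= G -> 0 < sg ->
  c = D / (sn * (G + sg)) ->
  eta * D ^+ 2 / c + 2 * eta * (G * (sn * D)) + 2 * (c * sn ^+ 2 * (G ^+ 2 + sg ^+ 2))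
  <= 5 * (eta * sn * D * (G + sg)).
Proof.
move=> eta1 D0 sn0 G0 sg0; have H0 : 0 < G + sg by lra.
move=> cE.
have e1 : eta * D ^+ 2 / c = eta * sn * D * (G + sg).
  by rewrite cE; field; rewrite !lt0r_neq0.
have e2 : c * sn ^+ 2 * (G ^+ 2 + sg ^+ 2) <= sn * D * (G + sg).
  have -> : c * sn ^+ 2 * (G ^+ 2 + sg ^+ 2) = sn * D * ((G ^+ 2 + sg ^+ 2) / (G + sg)).
    by rewrite cE; field; rewrite !lt0r_neq0.
  apply: ler_wpM2l; first by rewrite mulr_ge0// ltW.
  by rewrite ler_pdivrMr//; have := mulr_ge0 G0 (ltW sg0); lra.
rewrite e1; set z := sn * D * (G + sg) in e2 *.
have z0 : 0 <= z by rewrite !mulr_ge0// ltW.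
have e3 : G * (sn * D) <= z.
  rewrite /z mulrC; apply: ler_wpM2l; first by rewrite mulr_ge0// ltW.
  by rewrite lerDl ltW.
have e4 : eta * sn * D * (G + sg) = eta * z by rewrite /z !mulrA.
rewrite e4; move: (c * _ * _) (G * (sn * D)) e2 e3 => p q e2 e3.
nra.
Qed.

Theorem theorem7 (R : realType) :
  exists2 M : R, 0 < M &
  forall (n T s K : nat) (U : 'rV[R]_T -> R) (L : R)
    (C : 'rV[R]_s -> set 'rV[R]_T) (rho0 : 'rV[R]_s -> 'rV[R]_s -> R)
    (beta : 'I_n -> 'rV[R]_s) (dC eta eps : R),
  let Ci := fun i => C (beta i) in
  let rho := sup (norms Ci) in
  let G := sup (gradient_norms U Ci) in
  let Delta := sup (proj_gaps C rho0 beta dC) in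
  let bound := eta * Num.sqrt n%:R * rho *
    (G / Num.sqrt K%:R +
     Num.sqrt 2 * T%:R * (K%:R `^ (3 / 2)) * L * Delta / (2 * eps)) in
  (0 < n)%N -> (0 < T)%N -> (0 < K)%N ->
  convex_function setT U -> (forall x, differentiable U x) ->
  0 < L -> lipschitz_gradient U L ->
  (forall i, convex_set (Ci i)) -> (forall i, Ci i !=set0) ->
  is_metric rho0 -> 0 <= dC ->
  has_ubound (norms Ci) -> has_ubound (proj_gaps C rho0 beta dC) ->
  1 <= eta -> 0 < eps ->
  exists2 c : R, 0 < c &
  forall (d : measure_display) (Omega : measurableType d)
    (P : probability Omega R)
    (w : nat -> {RV P >-> T.-tuple (measurableTypeR R)})
    (r0 : 'I_n -> 'rV[R]_T) (r rhat : nat -> Omega -> 'I_n -> 'rV[R]_T),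
  dp_noise K (2 * eps / (K%:R * (K%:R - 1) * L * Delta)) w ->
  (forall o, dp_run K U Ci (fun k => c / Num.sqrt k%:R) eta r0
     (fun k => row_of_tuple (w k o)) (fun k => r k o) (fun k => rhat k o)) ->
  ('E_P[fun o => (U (\sum_(i < n) rhat K.+1 o i) - optimal_value U Ci)%R] <=
   (M * bound)%R%:E)%E.
Proof.
exists 40; first by [].
move=> n T s K U L C rho0 beta dC eta eps Ci rho G Delta bound n0 T0 K0 cU dU
  L0 LU cC C0 metric dC0 Cb Db eta1 eps0.
have rho_ge0 : 0 <= rho := radius_ge0 C0 Cb.
have G_ge0 : 0 <= G := gradient_bound_ge0 LU C0 Cb.
have Delta_ge0 : 0 <= Delta.
  have [p Cp] := C0 (Ordinal n0); have [_ rho00 _ _] := metric.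
  have Pp : is_proj (Ci (Ordinal n0)) p p.
    split=> // y Cy; rewrite !l2norm_sqr subrr dot0l; exact: dotvv_ge0.
  apply: le_trans (l2norm_ge0 (p - p)) _; apply: ub_le_sup => //.
  exists (Ordinal n0), (beta (Ordinal n0)), p, p, p; split => //.
  by rewrite (rho00 _ _).2.
have K_gt0 : 0 < K%:R :> R by rewrite ltr0n.
have sK : 0 < Num.sqrt K%:R :> R by rewrite sqrtr_gt0.
have sn : 0 < Num.sqrt n%:R :> R by rewrite sqrtr_gt0 ltr0n.
pose N := T%:R * (K%:R * Num.sqrt K%:R) * L * Delta / (2 * eps).
have N0 : 0 <= N.
  by rewrite /N !mulr_ge0 ?invr_ge0 ?mulr_ge0 ?(ltW sK)// ltW.
have sq2 : 1 <= Num.sqrt 2 :> R by rewrite -[X in X <= _]sqrtr1 ler_sqrt ?ler1n.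
have boundE : eta * Num.sqrt n%:R * rho * (G / Num.sqrt K%:R + N) <= bound.
  rewrite /bound powR_three_halves ?ler0n//; apply: ler_wpM2l.
    by rewrite !mulr_ge0 ?(ltW sn)// (le_trans ler01).
  rewrite lerD2l (_ : _ / (2 * eps) = Num.sqrt 2 * N); last by rewrite /N; ring.
  exact: ler_peMl.
have esr : 0 <= eta * Num.sqrt n%:R * rho.
  by rewrite !mulr_ge0 ?(ltW sn)// (le_trans ler01).
(* The diameter of the feasible set alone bounds the gap well enough. The balanced
   step size below would be zero if [rho] were. *)
have [crude|/norP[rho_neq0 K_neq1]] := boolP ((rho == 0) || (K == 1%N)).
  exists 1; first by [].
  move=> d Omega P w r0 r rhat noise run.
  apply: le_trans (run_crude_gap_le cU dU LU cC C0 Cb ltr01 eta1 run K0) _.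
  rewrite lee_fin -/G -/rho.
  apply: (@le_trans _ _ (40 * (eta * Num.sqrt n%:R * rho * (G / Num.sqrt K%:R + N)))); last first.
    exact: ler_wpM2l.
  case/orP: crude => /eqP.
    by move=> ->; rewrite !(mulr0, mul0r).
  move=> K1; rewrite [in G / _]K1 sqrtr1 divr1.
  have snr : 0 <= Num.sqrt n%:R * rho by rewrite mulr_ge0// ltW.
  have e1 := ler_wpM2r (mulr_ge0 snr G_ge0) eta1.
  have e2 := mulr_ge0 esr N0.
  have e3 := mulr_ge0 esr G_ge0.
  lra.
have rho_gt0 : 0 < rho by rewrite lt_neqAle eq_sym rho_neq0.
have [m Km] : exists m, K = m.+2.
  have K_gt1 : (1 < K)%N by rewrite ltn_neqAle eq_sym K_neq1.
  by exists K.-2; rewrite -subn2 -addn2 subnK.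
(* For [Delta = 0] the noise parameter is [0] since [0^-1 = 0], and no law has
   a density proportional to a positive constant. *)
have [Delta0|Delta_neq0] := eqVneq Delta 0.
  exists 1; first by [].
  move=> d Omega P w r0 r rhat [_ noise _] _; exfalso.
  have := noise 2%N; rewrite Km => /(_ isT) /noise_parameter_neq0.
  by rewrite Delta0 mulr0 invr0 mulr0 eqxx => /(_ T0).
have Delta_gt0 : 0 < Delta by rewrite lt_neqAle eq_sym Delta_neq0.
pose b := 2 * eps / (K%:R * (K%:R - 1) * L * Delta).
have K1_gt0 : 0 < K%:R - 1 :> R by rewrite subr_gt0 ltr1n Km.
have b0 : 0 < b by rewrite divr_gt0 ?mulr_gt0.
(* The root mean square of the norm of the noise is at most [sg]. *)
pose sg := 4 * T%:R / b.
have sg0 : 0 < sg by rewrite divr_gt0// mulr_gt0 ?ltr0n.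
have D0 : 0 < 2 * rho by rewrite mulr_gt0.
pose c := 2 * rho / (Num.sqrt n%:R * (G + sg)).
have c0 : 0 < c by rewrite divr_gt0 ?mulr_gt0 ?ltr_wpDl.
exists c => //.
move=> d Omega P w r0 r rhat [w1 noise indep] run.
apply: le_trans (run_expected_gap_le cU dU LU cC C0 Cb c0 eta1 w1 run Km T0 b0 indep noise) _.
rewrite lee_fin -/G -/rho -/sg.
apply: (@le_trans _ _ (40 * (eta * Num.sqrt n%:R * rho * (G / Num.sqrt K%:R + N)))); last first.
  exact: ler_wpM2l.
have := balanced_step_bound eta1 D0 sn G_ge0 sg0 (erefl c).
rewrite sqr_sqrtr ?ler0n// => step.
rewrite ler_pdivrMr//; apply: le_trans step _.
pose q := T%:R * K%:R * L * Delta / (2 * eps).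
have q0 : 0 <= q by rewrite /q !mulr_ge0 ?invr_ge0 ?mulr_ge0// ltW.
have sgE : sg = 4 * (q * (K%:R - 1)).
  by rewrite /sg /b /q invf_div; ring.
have NE : N * Num.sqrt K%:R = q * K%:R.
  transitivity (q * Num.sqrt K%:R ^+ 2); first by rewrite /N /q; ring.
  by rewrite sqr_sqrtr ?ler0n.
have -> : 40 * (eta * Num.sqrt n%:R * rho * (G / Num.sqrt K%:R + N)) * Num.sqrt K%:R =
    40 * (eta * Num.sqrt n%:R * rho * (G + N * Num.sqrt K%:R)).
  rewrite -[LHS]mulrA -[_ * (_ + N) * _]mulrA.
  by rewrite [(_ / _ + N) * _]mulrDl divfK// lt0r_neq0.
rewrite NE sgE.
have e1 := mulr_ge0 esr q0.
have e2 := mulr_ge0 esr G_ge0.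
have e3 := mulr_ge0 (mulr_ge0 esr q0) (ler0n R K).
lra.
Qed.
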